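(* Let $G$ be a finite simple graph. Let $G_1$ and $G_2$ be subgraphs of $G$ (not necessarily induced) which cover the cliques of $G$, i.e. every clique of $G$ is a clique in $G_1$ or a clique in $G_2$. Then \[\mathrm{reg}(G)\leq\max\{\mathrm{reg}(G_1),\ \mathrm{reg}(G_2),\ \mathrm{reg}(G_1\cap G_2)+1\},\] where $\mathrm{reg}$ denotes the Castelnuovo-Mumford regularity of the non-edge ideal.
   Context: All graphs are finite and simple. $G_1\cap G_2$ is the graph with vertex set $V(G_1)\cap V(G_2)$ and edge set $E(G_1)\cap E(G_2)$. A clique of a graph is a set of pairwise adjacent vertices (single vertices included). Fix a field $k$ of characteristic $0$. For a graph $G$ with vertex set $[n]$, the non-edge ideal is $I(G)=\langle x_ix_j : i\neq j,\ ij\notin E(G)\rangle\subseteq k[x_1,\dots,x_n]$ (the Stanley-Reisner ideal of the clique complex of $G$), and $\mathrm{reg}(G):=\max\{r : \beta_{i,i+r}(I(G))\neq 0 \text{ for some } i\}$ is its Castelnuovo-Mumford regularity, where $\beta_{i,j}$ are the graded Betti numbers. If $G$ is complete (so $I(G)=0$), $\mathrm{reg}(G)=1$ by convention; the graph with no vertices is counted as complete. *)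

(* Defs.v *)
From mathcomp Require Import all_boot all_order all_algebra.
From mathcomp Require Import mpoly.
From Stdlib Require Import ClassicalEpsilon.

Set Implicit Arguments.
Unset Strict Implicit.
Unset Printing Implicit Defensive.

Import GRing.Theory.
Local Open Scope ring_scope.

(* The carrier T is only an ambient supply of vertices: the vertex set of the
   graph is [vset], so subgraphs of a graph may have fewer vertices. *)
Record sgraph (T : finType) := SGraph {
  vset : {set T};
  edge : rel T;
  edge_sym : forall x y, edge x y = edge y x;
  edge_irr : irreflexive edge;
  edge_vset : forall x y, edge x y -> x \in vset
}.

Section Graphs.
Variable T : finType.
Implicit Types (G H : sgraph T) (C : {set T}).

Definition subgraph H G : Prop :=
  vset H \subset vset G /\ (forall x y, edge H x y -> edge G x y).

Definition clique G C : bool :=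
  (C \subset vset G) &&
  [forall x in C, forall y in C, (x != y) ==> edge G x y].

Definition complete G : bool := clique G (vset G).

Definition gcap_edge G H : rel T := fun x y => edge G x y && edge H x y.

Lemma gcap_sym G H x y : gcap_edge G H x y = gcap_edge G H y x.
Proof. by rewrite /gcap_edge (edge_sym G) (edge_sym H). Qed.

Lemma gcap_irr G H : irreflexive (gcap_edge G H).
Proof. by move=> x; rewrite /gcap_edge edge_irr. Qed.

Lemma gcap_vset G H x y : gcap_edge G H x y -> x \in vset G :&: vset H.
Proof.
by case/andP=> /edge_vset xG /edge_vset xH; rewrite inE xG xH.
Qed.

Definition gcap G H : sgraph T :=
  SGraph (@gcap_sym G H) (@gcap_irr G H) (@gcap_vset G H).

End Graphs.

Section Betti.
Variables (k : fieldType) (n : nat).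
Local Notation S := {mpoly k[n]}.

(* Data of a complex ... -> F_1 -> F_0 -> S of graded free modules, where
   F_i is the direct sum of the S(-d), d ranging over the list [shift i].
   Elements of F_i are row vectors, and maps act by right multiplication. *)
Record gcomplex := GComplex {
  shift : nat -> seq nat;
  aug : 'cV[S]_(size (shift 0));
  diff : forall i, 'M[S]_(size (shift i.+1), size (shift i))
}.

Definition trivial_gcomplex : gcomplex :=
  @GComplex (fun=> [::]) 0 (fun=> 0).

(* A map S(-d) -> S(-e) of degree 0 is multiplication by a form of degree
   d - e, hence is zero if d < e; 0 is homogeneous of every degree. *)
Definition graded_entry (d e : nat) (p : S) : bool :=
  if (e <= d)%N then p \is (d - e).-homog else p == 0.

Record is_min_resolution (I : S -> Prop) (F : gcomplex) : Prop := {
  aug_graded : forall a : 'I_(size (shift F 0)),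
    graded_entry (nth 0%N (shift F 0) a) 0 (aug F a 0);
  diff_graded : forall i (a : 'I_(size (shift F i.+1)))
      (b : 'I_(size (shift F i))),
    graded_entry (nth 0%N (shift F i.+1) a) (nth 0%N (shift F i) b)
                 (diff F i a b);
  aug_image : forall p, I p <-> exists v, v *m aug F = p%:M;
  exact_aug : forall v : 'rV_(size (shift F 0)),
    v *m aug F = 0 <-> exists w, v = w *m diff F 0;
  exact_diff : forall i (v : 'rV_(size (shift F i.+1))),
    v *m diff F i = 0 <-> exists w, v = w *m diff F i.+1;
  (* the entries lie in the maximal ideal generated by the variables *)
  minimal_diff : forall i a b, (diff F i a b)@_0%MM = 0
}.

(* Minimal graded free resolutions of a homogeneous ideal exist and are unique
   up to isomorphism, so the choice below is immaterial. *)
Definition min_resolution (I : S -> Prop) : gcomplex :=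
  epsilon (inhabits trivial_gcomplex) (is_min_resolution I).

Definition betti (I : S -> Prop) (i j : nat) : nat :=
  count_mem j (shift (min_resolution I) i).

Definition is_regularity (I : S -> Prop) (r : nat) : Prop :=
  (exists i, betti I i (i + r) <> 0%N) /\
  (forall i s, betti I i (i + s) <> 0%N -> (s <= r)%N).

(* The indices r with betti I i (i + r) <> 0 may be taken in nat, because
   I is contained in S, which has no elements of negative degree. *)
Definition regularity (I : S -> Prop) : nat :=
  epsilon (inhabits 0%N) (is_regularity I).

End Betti.

Section NonEdgeIdeal.
Variables (k : fieldType) (T : finType) (G : sgraph T).

(* The vertices of G are numbered by [enum_val], so that the polynomial ring
   has exactly one variable for each vertex of G. *)
Definition nonedge (i j : 'I_#|vset G|) : bool :=
  (i != j) && ~~ edge G (enum_val i) (enum_val j).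

Definition nonedge_ideal (p : {mpoly k[#|vset G|]}) : Prop :=
  exists c : 'I_#|vset G| -> 'I_#|vset G| -> {mpoly k[#|vset G|]},
    p = \sum_i \sum_(j | nonedge i j) c i j * ('X_i * 'X_j).

Definition reg : nat :=
  if complete G then 1%N else regularity nonedge_ideal.

End NonEdgeIdeal.

(* Main.v *)
(** By Hochster's formula, reg G is the largest b + 1 such that some induced
    subcomplex of the clique complex of G has nonzero reduced cohomology in
    dimension b - 1.  The clique complex of G is the union of those of G1 and
    G2, which meet in the clique complex of their intersection, so that
    Mayer-Vietoris, applied to induced subcomplexes, gives the inequality.

    For Hochster's formula, the Koszul homology of an ideal is compared with
    the shifts of a minimal resolution by dimension shifting along the syzygy
    modules, and is split into multigraded strands: a strand is a cone unless
    its multidegree is squarefree, and is then the cochain complex of a full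
    simplex relative to an induced subcomplex.  The same dimension shift
    carries the bound on the degrees of the Koszul homology to all syzygy
    modules; so these are generated in bounded degrees, and the minimal
    resolution exists without an appeal to Hilbert's basis theorem. *)

Require Import Defs.
From mathcomp Require Import all_boot all_order all_algebra.
From mathcomp Require Import mpoly.
From mathcomp Require Import zify ring.
From Stdlib Require Import ClassicalEpsilon.

Set Implicit Arguments.
Unset Strict Implicit.
Unset Printing Implicit Defensive.

Import GRing.Theory.

(** * Simplicial cochains *)

Lemma choice (A B : Type) (P : A -> B -> Prop) :
  (forall x, exists y, P x y) -> exists f, forall x, P x (f x).
Proof.
move=> H; exists (fun x => proj1_sig (constructive_indefinite_description _ (H x))).
by move=> x; apply: proj2_sig.
Qed.

Section Coboundary.
Local Open Scope ring_scope.
Variables (T : finType) (rho : T -> nat).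

(** With [rho] injective this is the position of [v] in [A] in the vertex order given by [rho]; its
    parity is the incidence sign. *)
Definition rk v (A : {set T}) : nat := #|[set u in A | rho u < rho v]%N|.

Lemma rkD1 u v (A : {set T}) : u \in A ->
  rk v A = ((rho u < rho v) + rk v (A :\ u))%N.
Proof.
move=> uA; rewrite /rk (cardsD1 u) !inE uA /=; congr (_ + _)%N.
by apply: eq_card => w; rewrite !inE andbA.
Qed.

Lemma rk_disjoint v (A B : {set T}) : [disjoint A & B] ->
  rk v (A :|: B) = (rk v A + rk v B)%N.
Proof.
move=> dAB; rewrite /rk -cardsUI -[LHS]addn0; congr (_ + _)%N.
  by apply: eq_card => w; rewrite !inE andb_orl.
apply/esym/eqP; rewrite cards_eq0; apply/eqP/setP => w; rewrite !inE.
by case wA: (w \in A); rewrite //= (disjointFr dAB wA) andbF.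
Qed.

Variables (R : comNzRingType) (V : lmodType R).
Implicit Types (x : T -> R) (c e f : {set T} -> V) (A B W : {set T}).

(** The weights let one formula serve twice: weights 1 give the simplicial coboundary, the variables
    as weights give the Koszul differential. *)
Definition dlt x c A : V :=
  \sum_(v in A) ((-1) ^+ rk v A * x v) *: c (A :\ v).

Lemma eq_dlt x c e A : (forall v, v \in A -> c (A :\ v) = e (A :\ v)) ->
  dlt x c A = dlt x e A.
Proof. by move=> ce; apply: eq_bigr => v vA; rewrite ce. Qed.

Lemma dltB x c e A : dlt x (fun B => c B - e B) A = dlt x c A - dlt x e A.
Proof. by rewrite -sumrB; apply: eq_bigr => v vA; rewrite scalerBr. Qed.

Lemma dltD x c e A : dlt x (fun B => c B + e B) A = dlt x c A + dlt x e A.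
Proof. by rewrite -big_split; apply: eq_bigr => v vA; rewrite scalerDr. Qed.

Lemma dlt0 x A : dlt x (fun=> 0) A = 0.
Proof. by rewrite /dlt big1 // => v _; rewrite scaler0. Qed.

Hypothesis rho_inj : injective rho.

(** Deleting two vertices in either order gives the same weights with opposite signs, because
    deleting the smaller vertex lowers the rank of the larger one by one. *)
Lemma dlt_dlt x c A : dlt x (dlt x c) A = 0.
Proof.
pose F v u : V := ((-1) ^+ rk v A * x v) *:
  (((-1) ^+ rk u (A :\ v) * x u) *: c (A :\ v :\ u)).
have Fanti v u : v \in A -> u \in A -> (rho v < rho u)%N -> F u v = - F v u.
  move=> vA uA lt_vu; rewrite /F !scalerA -scaleNr setDDl setUC -setDDl.
  congr (_ *: _); rewrite (rkD1 u vA) (rkD1 v uA) lt_vu.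
  rewrite ltnNge (ltnW lt_vu) /= add0n add1n exprS.
  by ring.
transitivity (\sum_(v in A) \sum_(u in A | v != u) F v u).
  apply: eq_bigr => v vA; rewrite /dlt scaler_sumr; apply: eq_big => u //.
  by rewrite !inE andbC eq_sym.
transitivity (\sum_(v in A) (\sum_(u in A | (rho v < rho u)%N) F v u
                           + \sum_(u in A | (rho u < rho v)%N) F v u)).
  apply: eq_bigr => v vA.
  rewrite (bigID (fun u => (rho v < rho u)%N)) /=; congr (_ + _); apply: eq_bigl.
    move=> u; case: (u \in A) => //=; case: eqP => [->|//]; by rewrite ltnn.
  move=> u; case: (u \in A) => //=; rewrite -leqNgt ltn_neqAle.
  by rewrite (inj_eq rho_inj) eq_sym.
rewrite big_split /= [X in _ + X](exchange_big_dep (fun u => u \in A)) /=; last first.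
  by move=> v u _ /andP[].
rewrite -big_split big1 //= => v vA.
rewrite [X in _ + X](eq_bigl (fun u => (u \in A) && (rho v < rho u)%N)); last first.
  by move=> u; rewrite vA.
rewrite -big_split big1 //= => u /andP[uA lt].
by rewrite (Fanti v u) // subrr.
Qed.

Definition ctr u c A : V :=
  if u \in A then 0 else (-1) ^+ rk u A *: c (u |: A).

(** [ctr u] is a homotopy from multiplication by [x u] to zero. If [u] is in [A], only the term
    deleting [u] survives; otherwise that term of the second summand gives the right side and the
    other terms cancel in pairs. *)
Lemma dlt_ctr x u c A :
  dlt x (ctr u c) A + ctr u (dlt x c) A = x u *: c A.
Proof.
have rkuu B : rk u (u |: B) = rk u (B :\ u).
  rewrite (@rkD1 u) ?setU11 // ltnn; congr (rk u _).
  by apply/setP => w; rewrite !inE; case: eqP.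
rewrite {2}/ctr; case: (boolP (u \in A)) => uA.
  rewrite addr0 /dlt (bigD1 u) //= big1 ?addr0 => [|v /andP[vA vu]].
    rewrite /ctr setD11 scalerA (rkD1 u uA) ltnn add0n setD1K //.
    by rewrite mulrAC -expr2 sqrr_sign mul1r.
  by rewrite /ctr !inE eq_sym vu uA /= scaler0.
rewrite {2}/dlt scaler_sumr big_setU1 //= setU1K // addrCA.
rewrite rkuu setDE; have -> : A :&: ~: [set u] = A.
  by apply/setIidPl/subsetP => w wA; rewrite !inE; apply: contraNneq uA => <-.
rewrite scalerA mulrA -expr2 sqrr_sign mul1r -[RHS]addr0; congr (_ + _).
rewrite -big_split big1 //= => v vA.
have vu : v != u by apply: contraNneq uA => <-.
rewrite /ctr !inE eq_sym (negbTE vu) /= (negbTE uA).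
have -> : u |: A :\ v = (u |: A) :\ v.
  apply/setP => w; rewrite !inE; case: (w =P u) => [->|] //=.
  by rewrite eq_sym vu.
rewrite !scalerA -scalerDl; apply/eqP.
have -> : rk v (u |: A) = ((rho u < rho v) + rk v A)%N.
  by rewrite (@rkD1 u) ?setU11 // setU1K.
rewrite (rkD1 u vA).
have : (rho u < rho v)%N = ~~ (rho v < rho u)%N.
  by rewrite -leqNgt ltn_neqAle (inj_eq rho_inj) eq_sym vu.
move=> ->; rewrite !exprD.
set a := (-1) ^+ rk v A; set b := (-1) ^+ rk u _.
have -> : a * x v * b + (-1) ^+ (rho v < rho u)%N * b *
  ((-1) ^+ (~~ (rho v < rho u)%N) * a * x v) = 0.
  by case: (rho v < rho u)%N => /=; rewrite ?expr1 ?expr0; ring.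
by rewrite scale0r.
Qed.

End Coboundary.

(** * Absolute and relative cohomology of induced subcomplexes, and Mayer-Vietoris *)

Section SimplicialCohomology.
Local Open Scope ring_scope.
Variables (k : fieldType) (T : finType) (rho : T -> nat).
Hypothesis rho_inj : injective rho.
Implicit Types (c e f : {set T} -> k^o) (A B W : {set T}) (D : pred {set T}).

Definition dlt1 c : {set T} -> k^o := dlt rho (fun=> 1) c.

Definition down_closed D : Prop := forall A B, A \subset B -> D B -> D A.

(* Cochains are indexed by the cardinality of the faces: this is the reduced
   cohomology in dimension [b - 1] of the subcomplex of [D] induced on [W]. *)
Definition coh D W b : Prop := exists c,
  (forall B, B \subset W -> #|B| = b.+1 -> D B -> dlt1 c B = 0) /\
  ~ exists e, forall B, B \subset W -> #|B| = b -> D B -> dlt1 e B = c B.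

(* The cohomology of the pair consisting of the full simplex on [W] and [D]. *)
Definition rcoh D W b : Prop := exists c,
  [/\ forall B, B \subset W -> #|B| = b -> D B -> c B = 0,
      forall B, B \subset W -> #|B| = b.+1 -> dlt1 c B = 0 &
  ~ exists e, (forall B, B \subset W -> #|B|.+1 = b -> D B -> e B = 0) /\
    forall B, B \subset W -> #|B| = b -> dlt1 e B = c B].

Lemma cards_setD1_add v A i N : v \in A -> (#|A| + i)%N = N ->
  (#|A :\ v| + i.+1)%N = N.
Proof. by move=> vA <-; rewrite (cardsD1 v A) vA add1n addSnnS. Qed.

Lemma subset_setD1 u B W : B \subset W -> B :\ u \subset W.
Proof. by move=> sBW; apply: subset_trans sBW; apply: subsetDl. Qed.

Lemma dlt1_dlt1 c A : dlt1 (dlt1 c) A = 0.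
Proof. exact: dlt_dlt. Qed.

Lemma dlt1_ctr u c B : (u \notin B -> dlt1 c (u |: B) = 0) ->
  dlt1 (ctr rho u c) B = c B.
Proof.
move=> cB; have := dlt_ctr rho_inj (fun=> 1) u c B.
rewrite scale1r => <-; rewrite -[LHS]addr0; congr (_ + _).
by rewrite {1}/ctr; case: ifPn => // /cB; rewrite /dlt1 => ->; rewrite scaler0.
Qed.

(** Any vertex of [W] gives a contracting homotopy. For empty [W] there is none, and a class
    survives at [b = 0]. *)
Lemma simplex_acyclic c W b : W != set0 ->
  (forall B, B \subset W -> #|B| = b.+1 -> dlt1 c B = 0) ->
  exists e, forall B, B \subset W -> #|B| = b -> dlt1 e B = c B.
Proof.
case/set0Pn => u uW cW; exists (ctr rho u c) => B sBW cB.
apply: dlt1_ctr => uB; apply: cW; last by rewrite cardsU1 uB cB.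
by rewrite subUset sub1set uW.
Qed.

(** If all three groups on the right vanish, primitives on [D1] and on [D2] differ on the
    intersection by a coboundary, and glue once the second is corrected by it. *)
Lemma mayer_vietoris D1 D2 W b : down_closed D1 -> down_closed D2 ->
  coh (fun B => D1 B || D2 B) W b ->
  [\/ coh D1 W b, coh D2 W b |
      0 < b /\ coh (fun B => D1 B && D2 B) W b.-1]%N.
Proof.
move=> cl1 cl2 [c [cc nc]]; apply: NNPP => /[dup] N1 /[dup] N2 N3.
have [e1 He1] : exists e, forall B, B \subset W -> #|B| = b -> D1 B -> dlt1 e B = c B.
  apply: NNPP => ne; apply: N1; constructor 1; exists c; split=> // B sB cB DB.
  by apply: cc => //; rewrite DB.
have [e2 He2] : exists e, forall B, B \subset W -> #|B| = b -> D2 B -> dlt1 e B = c B.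
  apply: NNPP => ne; apply: N2; constructor 2; exists c; split=> // B sB cB DB.
  by apply: cc => //; rewrite DB orbT.
have [f Hf] : exists f, forall B, B \subset W -> #|B|.+1 = b -> D1 B && D2 B ->
    dlt1 f B = e1 B - e2 B.
  (* For [b = 0] no set has cardinality [b - 1], so any [f] serves. *)
  case: b => [|b] in cc nc N1 N2 N3 He1 He2 *; first by exists (fun=> 0).
  apply: NNPP => nf; apply: N3; constructor 3; split=> //.
  exists (fun B => e1 B - e2 B); split.
    move=> B sB cB /andP[d1 d2]; rewrite /dlt1 dltB -![dlt _ _ _ _]/(dlt1 _ _).
    by rewrite He1 // He2 // subrr.
  by case=> f Hf; apply: nf; exists f => B sB [cB]; apply: Hf.
(* For a face [B] of [D2] outside [D1], some of the sets [B :\ v] may lie in [D1]; there [e1] equals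
   [e2 + dlt1 f], so the case split does no harm. *)
apply: nc; exists (fun B => if D1 B then e1 B else e2 B + dlt1 f B) => B sB cB.
case: (boolP (D1 B)) => [d1 _|nd1 /= d2].
  rewrite -(He1 B) //; apply: eq_dlt => v vB.
  by rewrite (cl1 _ B) // subsetDl.
rewrite -(He2 B) // -[RHS]addr0 -[in RHS](dlt1_dlt1 f B) -dltD.
apply: eq_dlt => v vB; case: ifP => // d1; rewrite Hf ?subrKC //.
- exact: subset_setD1.
- by rewrite -cB [RHS](cardsD1 v) vB.
- by rewrite d1 (cl2 _ B) // subsetDl.
Qed.

(** The connecting map of the pair: extend by zero to the full simplex and take the coboundary. It
    is injective because the full simplex is acyclic. *)
Lemma coh_rcoh D W b : down_closed D -> W != set0 ->
  coh D W b -> rcoh D W b.+1.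
Proof.
move=> clD W0 [c [cc nc]].
pose c0 B := if D B then c B else 0.
exists (dlt1 c0); split.
- move=> B sB cB DB; rewrite -(cc B) //; apply: eq_dlt => v vB.
  by rewrite /c0 (clD _ B) // subsetDl.
- by move=> B _ _; apply: dlt1_dlt1.
case=> e [e0 He]; have [f Hf] : exists f, forall B, B \subset W -> #|B| = b ->
    dlt1 f B = c0 B - e B.
  apply: simplex_acyclic => // B sB cB.
  by rewrite /dlt1 dltB -![dlt _ _ _ _]/(dlt1 _ _) He // subrr.
apply: nc; exists f => B sB cB DB.
by rewrite Hf // /c0 DB e0 ?subr0 // cB.
Qed.

(** The connecting map is inverted by restricting to [D] a primitive taken on the full simplex. *)
Lemma rcoh_coh D W s : down_closed D -> D set0 -> W != set0 ->
  rcoh D W s -> (0 < s)%N /\ coh D W s.-1.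
Proof.
move=> clD D0 W0 [c [c0 cc nc]].
case: s => [|s] in c0 cc nc *.
  (* The empty set is a face, so a relative cochain vanishes on it and [s = 0] cannot occur. *)
  case: nc; exists (fun=> 0); split=> // B sB /eqP; rewrite cards_eq0 => /eqP->.
  by rewrite c0 ?cards0 ?sub0set // /dlt1 /dlt big_set0.
split=> //=; have [e He] := simplex_acyclic W0 cc.
exists e; split=> [B sB cB DB|[f Hf]]; first by rewrite He // c0.
apply: nc; exists (fun B => e B - dlt1 f B); split.
  by move=> B sB [cB] DB; rewrite Hf // subrr.
move=> B sB cB; rewrite /dlt1 dltB -![dlt _ _ _ _]/(dlt1 _ _) dlt1_dlt1 subr0.
exact: He.
Qed.

Lemma rcoh_card D W s : rcoh D W s -> (s <= #|W|)%N.
Proof.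
case=> c [_ _ nc]; rewrite leqNgt; apply/negP => lt; apply: nc.
exists (fun=> 0); split=> // B /subset_leq_card le eB.
by move: lt; rewrite -eB ltnNge le.
Qed.

Lemma eq_coh D D' W b : (forall B, B \subset W -> D B = D' B) ->
  coh D W b -> coh D' W b.
Proof.
move=> eD [c [cc nc]]; exists c; split=> [B sB cB DB|[e He]].
  by apply: cc => //; rewrite eD.
by apply: nc; exists e => B sB cB DB; apply: He => //; rewrite -eD.
Qed.

Lemma coh_subset D W W' b : (forall B, B \subset W -> D B -> B \subset W') ->
  W' \subset W -> coh D W b <-> coh D W' b.
Proof.
move=> sD sW; split=> -[c [cc nc]]; exists c; split.
- by move=> B sB; apply: cc; apply: subset_trans sW.
- by case=> e He; apply: nc; exists e => B sB cB DB; apply: He => //; apply: sD.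
- by move=> B sB cB DB; apply: cc => //; apply: sD.
case=> e He; apply: nc; exists e => B sB cB DB; apply: He => //.
exact: subset_trans sW.
Qed.

End SimplicialCohomology.

(** * Transport of cohomology along an injection of vertex sets *)

Section CohomologyPullback.
Local Open Scope ring_scope.
Variables (k : fieldType) (T T' : finType) (f : T' -> T) (rho : T -> nat).
Hypothesis f_inj : injective f.

Lemma rk_imset v (A : {set T'}) : rk rho (f v) (f @: A) = rk (rho \o f) v A.
Proof.
rewrite /rk -(card_imset (mem [set u in A | _]) f_inj); apply: eq_card => w.
rewrite !inE; apply/andP/imsetP => [[/imsetP[u uA ->] lt]|[u]].
  by exists u => //; rewrite !inE uA.
by rewrite !inE => /andP[uA lt] ->; rewrite imset_f.
Qed.

Lemma imset_setD1 v (A : {set T'}) : f @: (A :\ v) = f @: A :\ f v.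
Proof.
apply/setP => w; rewrite !inE; apply/imsetP/andP => [[u]|[wv /imsetP[u uA ew]]].
  by rewrite !inE => /andP[uv uA] ->; rewrite (inj_eq f_inj) uv imset_f.
by exists u => //; rewrite !inE uA -(inj_eq f_inj) -ew wv.
Qed.

Lemma dlt1_imset (c : {set T} -> k^o) (A : {set T'}) :
  dlt1 rho c (f @: A) = dlt1 (rho \o f) (fun B : {set T'} => c (f @: B)) A.
Proof.
rewrite /dlt1 /dlt big_imset /=; last by move=> x y _ _ /f_inj.
by apply: eq_bigr => v vA; rewrite rk_imset -imset_setD1.
Qed.

Lemma coh_imset (D : pred {set T}) (W : {set T'}) b :
  coh k rho D (f @: W) b <-> coh k (rho \o f) (fun B : {set T'} => D (f @: B)) W b.
Proof.
have preK (B : {set T'}) : f @^-1: (f @: B) = B.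
  by apply/setP => v; rewrite inE (mem_imset _ _ f_inj).
have imK (B : {set T}) : B \subset f @: W -> exists2 B' : {set T'}, B = f @: B' & B' \subset W.
  move=> sB; exists (f @^-1: B); last by rewrite -(preK W) preimsetS.
  apply/setP => v; apply/idP/imsetP => [vB|[u]]; last by rewrite inE => uB ->.
  have /imsetP[u uW ev] := subsetP sB v vB.
  by exists u; rewrite // inE -ev.
split=> -[c [cc nc]].
  exists (fun B : {set T'} => c (f @: B)); split.
    by move=> B sB cB DB; rewrite -dlt1_imset cc ?imsetS // card_imset.
  case=> e He; apply: nc; exists (fun B : {set T} => e (f @^-1: B)) => B sB.
  have [B' -> sB'] := imK _ sB; rewrite card_imset // => cB DB.
  by rewrite dlt1_imset -He //; apply: eq_dlt => v vB; rewrite preK.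
exists (fun B : {set T} => c (f @^-1: B)); split.
  move=> B sB; have [B' -> sB'] := imK _ sB; rewrite card_imset // => cB DB.
  by rewrite dlt1_imset -(cc B') //; apply: eq_dlt => v vB; rewrite preK.
case=> e He; apply: nc; exists (fun B : {set T'} => e (f @: B)) => B sB cB DB.
by rewrite -dlt1_imset He ?imsetS ?card_imset // preK.
Qed.

End CohomologyPullback.

(** * Strands of the Koszul complex *)

Section Indicator.
Variable n : nat.
Implicit Types (A B W : {set 'I_n}) (m : 'X_{1..n}).

Definition chi A : 'X_{1..n} := [multinom (v \in A : nat) | v < n].
Definition supp m : {set 'I_n} := [set v | 0 < m v].

Lemma chiE A v : chi A v = (v \in A).
Proof. exact: mnmE. Qed.

Lemma mdeg_chi A : mdeg (chi A) = #|A|.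
Proof.
rewrite mdegE -sum1_card [RHS]big_mkcond /=; apply: eq_bigr => v _.
by rewrite chiE; case: (v \in A).
Qed.

Lemma chi_le A m : (chi A <= m)%MM = (A \subset supp m).
Proof.
apply/mnm_lepP/subsetP => [le v vA|sA v].
  by have := le v; rewrite chiE vA inE.
by rewrite chiE; case: (boolP (v \in A)) => // /sA; rewrite inE.
Qed.

Lemma supp_chi A : supp (chi A) = A.
Proof. by apply/setP => v; rewrite inE chiE lt0b. Qed.

Lemma chi_setC_D1 A v : v \in A -> chi (~: (A :\ v)) = (chi (~: A) + U_(v))%MM.
Proof.
move=> vA; apply/mnmP => u; rewrite mnmDE mnm1E !chiE !inE eq_sym.
by case: eqP => [<-|]; rewrite ?vA ?addn0.
Qed.

Lemma chi_supp m : (forall v, m v <= 1) -> chi (supp m) = m.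
Proof. by move=> m1; apply/mnmP => v; rewrite chiE inE; move: (m1 v); lia. Qed.

End Indicator.

Section Strands.
Local Open Scope ring_scope.
Variables (k : fieldType) (n : nat) (rho : 'I_n -> nat).
Hypothesis rho_inj : injective rho.
Local Notation S := {mpoly k[n]}.
Implicit Types (A B W : {set 'I_n}) (al m : 'X_{1..n}).

Definition dltX p (c : {set 'I_n} -> 'rV[S]_p) : {set 'I_n} -> 'rV[S]_p :=
  dlt rho (fun v => 'X_v : S) c.

(* The homogeneous component of multidegree [al] of a Koszul cochain, where a
   form sitting on [A] gets its multidegree raised by the complement of [A]. *)
Definition strand al (c : {set 'I_n} -> S) A : k^o :=
  if (chi (~: A) <= al)%MM then (c A)@_(al - chi (~: A)) else 0.

Lemma mcoeff_XM v (q : S) m :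
  ('X_v * q)@_m = if (0 < m v)%N then q@_(m - U_(v)) else 0.
Proof.
rewrite mulrC; case: ifPn => [mv|mv].
  have le : (U_(v) <= m)%MM.
    by apply/mnm_lepP => u; rewrite mnm1E; case: eqP => [<-|].
  by rewrite -{1}(submK le) addmC mcoeffMX.
apply/eqP; rewrite mcoeff_eq0 (perm_mem (msuppMX _ _)); apply/mapP => -[m' _ em].
by move: mv; rewrite em mnmDE mnm1E eqxx.
Qed.

Lemma dltX_entry p (c : {set 'I_n} -> 'rV[S]_p) A a :
  dltX c A 0 a = \sum_(v in A) (-1) ^+ rk rho v A *: ('X_v * c (A :\ v) 0 a).
Proof.
rewrite summxE; apply: eq_bigr => v vA; rewrite mxE -mulrA.
rewrite -signr_odd -[in RHS]signr_odd.
by case: odd; rewrite ?expr0 ?expr1 ?mul1r ?scale1r // mulN1r scaleN1r.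
Qed.

(** Passing from [A :\ v] to [A] multiplies by ['X_v] and removes [v] from the complement; the two
    changes of multidegree cancel, so within a strand every variable acts as 1. *)
Lemma strand_dlt p al (c : {set 'I_n} -> 'rV[S]_p) a A :
  strand al (fun B => dltX c B 0 a) A =
  dlt1 rho (strand al (fun B => c B 0 a)) A.
Proof.
rewrite /dlt1 /dlt {1}/strand; case: ifPn => le.
  rewrite dltX_entry raddf_sum; apply: eq_bigr => v vA.
  rewrite /= mcoeffZ mcoeff_XM mulr1; congr (_ * _).
  rewrite /strand chi_setC_D1 // submDA; congr (if _ then _ else _).
  apply/idP/mnm_lepP => [lt u|/(_ v)].
    rewrite mnmDE mnm1E; move: lt (mnm_lepP le u); rewrite mnmBE.
    by case: eqP => [->|]; lia.
  by rewrite mnmDE mnm1E eqxx mnmBE; lia.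
rewrite big1 // => v vA; rewrite /strand chi_setC_D1 //.
case: ifPn => [le'|]; last by rewrite scaler0.
case/negP: le; apply: lepm_trans le'; exact: lem_addr.
Qed.

Lemma mcoeff_sum_bounded N (E : 'X_{1..n} -> k) m :
  (forall m', (N <= mdeg m')%N -> E m' = 0) ->
  (\sum_(m' : 'X_{1..n < N}) E m' *: 'X_[m'])@_m = E m.
Proof.
move=> E0; case: (ltnP (mdeg m) N) => [lt|le]; first exact: mcoeff_mpoly.
rewrite E0 // raddf_sum big1 //= => m' _; rewrite mcoeffZ mcoeffX.
case: eqP => [em|]; rewrite ?mulr0 //.
by have := bmdeg m'; rewrite em ltnNge le.
Qed.

(** Primitives found strand by strand assemble to polynomial ones. [P] singles out the admissible
    monomials, so that primitives can be kept inside a monomial ideal. *)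
Lemma strand_glue p (P : pred 'X_{1..n}) (c : {set 'I_n} -> 'rV[S]_p) i :
  (forall a al, exists e : {set 'I_n} -> k^o,
     (forall A, (#|A| + i.+1)%N = n -> e A != 0 ->
        (chi (~: A) <= al)%MM /\ P (al - chi (~: A))%MM) /\
     (forall A, (#|A| + i)%N = n ->
        dlt1 rho e A = strand al (fun B => c B 0 a) A)) ->
  exists w : {set 'I_n} -> 'rV[S]_p,
     (forall A, (#|A| + i.+1)%N = n -> forall a m, (w A 0 a)@_m != 0 -> P m) /\
     (forall A, (#|A| + i)%N = n -> dltX w A = c A).
Proof.
move=> H; pose N := (\max_A \max_a msize (c A 0%R a))%N.
have cN A a m : (N <= mdeg m)%N -> (c A 0 a)@_m = 0.
  move=> le; apply/eqP; rewrite mcoeff_eq0; apply: contraL le => /msize_mdeg_lt lt.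
  rewrite -ltnNge; apply: leq_trans lt _; apply: leq_trans (leq_bigmax A).
  exact: leq_bigmax a.
(* All coefficients of [c] have degree below [N] and the complement of [A] has [i] elements, so
   strands of degree at least [N + i] vanish. Choosing the zero primitive there leaves finitely many
   monomials in [w]. *)
have {}H a al : exists e : {set 'I_n} -> k^o,
     [/\ (forall A, (#|A| + i.+1)%N = n -> e A != 0 ->
        (chi (~: A) <= al)%MM /\ P (al - chi (~: A))%MM),
     (forall A, (#|A| + i)%N = n ->
        dlt1 rho e A = strand al (fun B => c B 0 a) A) &
     (N + i <= mdeg al)%N -> forall A, e A = 0].
  case: (leqP (N + i) (mdeg al)) => [le|lt]; last first.
    by have [e [e1 e2]] := H a al; exists e.
  exists (fun=> 0); split=> // A; first by rewrite eqxx.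
  move=> cA; rewrite /dlt1 dlt0 /strand; case: ifP => // leA; rewrite cN //.
  have : mdeg al = (mdeg (al - chi (~: A)) + #|~: A|)%N.
    by rewrite -mdeg_chi -mdegD submK.
  by have := cardsC A; rewrite card_ord; lia.
have [e He] := @choice _ _ _ (fun a => @choice _ _ _ (H a)).
pose w A := \row_a (\sum_(m : 'X_{1..n < N}) e a (m + chi (~: A))%MM A *: 'X_[m]) : 'rV[S]_p.
have wE A a m : (#|A| + i.+1 = n)%N -> (w A 0 a)@_m = e a (m + chi (~: A))%MM A.
  move=> cA; rewrite mxE (@mcoeff_sum_bounded N (fun m => e a (m + chi (~: A))%MM A)) // => m' le.
  have [_ _ e0] := He a (m' + chi (~: A))%MM; apply: e0; rewrite mdegD mdeg_chi.
  by have := cardsC A; rewrite card_ord; lia.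
exists w; split=> [A cA a m|A cA].
  have [He1 _ _] := He a (m + chi (~: A))%MM.
  by rewrite wE // => /(He1 _ cA)[_]; rewrite addmK.
apply/rowP => a; apply/mpolyP => m.
have strandE (q : {set 'I_n} -> 'rV[S]_p) : (q A 0 a)@_m =
    strand (m + chi (~: A)) (fun B => q B 0 a) A.
  by rewrite /strand lem_addl addmK.
rewrite (strandE (dltX w)) (strandE c) strand_dlt; have [He1 He2 _] := He a (m + chi (~: A))%MM.
rewrite -He2 //; apply: (@eq_dlt _ _ _ k^o) => v vA; rewrite /strand.
have cAv := cards_setD1_add vA cA.
case: ifPn => le; first by rewrite wE // submK.
by apply/esym/eqP; apply: contraNT le => /He1 [].
Qed.

(** The Koszul complex of a free module is exact, except for the constant terms at [i = 0]: a strand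
    is contracted by any vertex of its support, and the strand of multidegree 0 lives on [setT]
    alone. *)
Lemma free_acyclic p (c : {set 'I_n} -> 'rV[S]_p) i :
  (forall A, (#|A| + i)%N = n.+1 -> dltX c A = 0) ->
  (i = 0%N -> forall a, (c setT 0 a)@_0%MM = 0) ->
  exists w, (forall A, (#|A| + i)%N = n -> dltX w A = c A).
Proof.
move=> cc c0; have [|w [_ Hw]] := @strand_glue p xpredT c i; last by exists w.
move=> a al; pose s := strand al (fun B => c B 0 a).
have sc A : (#|A| + i = n.+1)%N -> dlt1 rho s A = 0.
  by move=> cA; rewrite -strand_dlt /strand cc // mxE mcoeff0 if_same.
case: (boolP (supp al == set0)) => [/eqP al0|/set0Pn[u ual]].
  exists (fun=> 0); split=> A; first by rewrite eqxx.
  move=> cA; rewrite /dlt1 dlt0 /strand chi_le al0 subset0.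
  case: eqP => //; rewrite -setCT => /(can_inj (@setCK _)) eA.
  have i0 : i = 0%N by move: cA; rewrite eA cardsT card_ord; lia.
  suff -> : (al - chi (~: A) = 0)%MM by rewrite eA c0.
  apply/mnmP => v; rewrite mnmBE mnm0E eA chiE setCT inE subn0.
  by have := in_set0 v; rewrite -al0 inE; case: (al v).
exists (ctr rho u s); split=> A cA.
  rewrite /ctr; case: ifP; first by rewrite eqxx.
  move=> uA; rewrite scaler_eq0 negb_or => /andP[_]; rewrite /s /strand !chi_le.
  case: ifP; last by rewrite eqxx.
  move=> /subsetP sA _; split=> //; apply/subsetP => v vA.
  by case: (eqVneq v u) => [->//|vu]; apply: sA; move: vA; rewrite !inE (negbTE vu).
apply: dlt1_ctr => // uA; apply: sc; rewrite cardsU1 uA; lia.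
Qed.

End Strands.

(** * Koszul homology of nonface ideals *)

(* [lia] does not identify cardinals whose types differ by a [reverse_coercion]. *)
Ltac cardlia := cbv beta delta [reverse_coercion] in *; lia.
Section Hochster.
Local Open Scope ring_scope.
Variables (k : fieldType) (n : nat) (rho : 'I_n -> nat).
Hypothesis rho_inj : injective rho.
Local Notation S := {mpoly k[n]}.
Implicit Types (A B W C : {set 'I_n}) (al m : 'X_{1..n}) (s : seq nat).

Definition vhom s d (v : 'rV[S]_(size s)) : Prop :=
  forall a m, (v 0 a)@_m != 0 -> (mdeg m + nth 0%N s a)%N = d.

(* Nonvanishing of the Koszul homology in homological degree [i] and internal
   degree [t + i] of a graded submodule [M] of the free module generated in
   degrees [s].  Cochains of cardinality [n - i] play the role of the
   [i]-chains, by self-duality of the Koszul complex. *)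
Definition koszul s (M : 'rV[S]_(size s) -> Prop) i t : Prop :=
  exists z : {set 'I_n} -> 'rV[S]_(size s),
  [/\ forall A, (#|A| + i)%N = n -> M (z A) /\ vhom t (z A),
      forall A, (#|A| + i)%N = n.+1 -> dltX rho z A = 0 &
      ~ exists w : {set 'I_n} -> 'rV[S]_(size s),
        (forall A, (#|A| + i.+1)%N = n -> M (w A)) /\
        (forall A, (#|A| + i)%N = n -> dltX rho w A = z A)].

Lemma card_setUC B W : B \subset W -> #|B :|: ~: W| = (#|B| + #|~: W|)%N.
Proof.
move=> sB; rewrite cardsU; have -> : B :&: ~: W = set0.
  by apply/eqP; rewrite setI_eq0 -subsets_disjoint.
by rewrite cards0 subn0.
Qed.

Lemma setUCI B W : B \subset W -> (B :|: ~: W) :&: W = B.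
Proof.
by move=> sB; rewrite setIUl [~: W :&: W]setIC setICr setU0; apply/setIidPl.
Qed.

Lemma setIUC A W : ~: W \subset A -> A :&: W :|: ~: W = A.
Proof. by move=> sA; rewrite setUIl setUCr setIT; apply/setUidPl. Qed.

Lemma card_setIUC A W : ~: W \subset A -> #|A| = (#|A :&: W| + #|~: W|)%N.
Proof. by move=> sA; rewrite -[in LHS](setIUC sA) card_setUC // subsetIr. Qed.

Definition twist C B : k := \prod_(v in B) (-1) ^+ rk rho v C.

Lemma twistK C B : twist C B * twist C B = 1.
Proof. by rewrite -big_split big1 //= => v _; rewrite -expr2 sqrr_sign. Qed.

(** Subsets [B] of [W] correspond to the sets [B :|: ~: W]. Deleting a vertex outside [W] leaves the
    support of [a], and [twist] absorbs what [~: W] adds to the ranks. *)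
Lemma dlt1_twist W (a : {set 'I_n} -> k^o) B :
  (forall A, ~~ (~: W \subset A) -> a A = 0) -> B \subset W ->
  dlt1 rho a (B :|: ~: W) =
  twist (~: W) B *: dlt1 rho (fun B => twist (~: W) B *: a (B :|: ~: W)) B.
Proof.
move=> a0 sBW; have dBW : [disjoint B & ~: W] by rewrite -subsets_disjoint.
rewrite /dlt1 /dlt (eq_bigl [predU B & ~: W]) => [|v]; last by rewrite !inE.
rewrite bigU //= addrC big1 ?add0r => [|v vW]; last first.
  rewrite a0 ?scaler0 //; apply/subsetPn; exists v => //; by rewrite !inE eqxx.
rewrite scaler_sumr; apply: eq_bigr => v vB.
have -> : (B :|: ~: W) :\ v = B :\ v :|: ~: W.
  apply/setP => u; rewrite !inE; case: (u =P v) => [->|] //=.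
  by rewrite (subsetP sBW).
rewrite rk_disjoint // exprD !scalerA !mulr1; congr (_ *: _).
have -> : twist (~: W) B = (-1) ^+ rk rho v (~: W) * twist (~: W) (B :\ v).
  rewrite /twist (bigD1 v) //=; congr (_ * _); apply: eq_bigl => u.
  by rewrite !inE andbC.
have := twistK (~: W) (B :\ v); set t := twist _ _ => tt.
transitivity ((-1) ^+ rk rho v B * (-1) ^+ rk rho v (~: W) * (t * t)).
  by rewrite tt mulr1.
ring.
Qed.

Variable D : pred {set 'I_n}.

Definition nonface m := ~~ D (supp m).

(** For down-closed [D], the Stanley-Reisner ideal, given by its monomials and placed in the free
    module on one generator of degree 0. *)
Definition nonface_ideal (v : 'rV[S]_(size [:: 0%N])) : Prop :=
  forall m, (v 0 0)@_m != 0 -> nonface m.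

Lemma supp_chi_compl A al : (chi (~: A) <= al)%MM -> (forall v, al v <= 1)%N ->
  supp (al - chi (~: A)) = A :&: supp al.
Proof.
rewrite chi_le => /subsetP sA al1; apply/setP => v; rewrite !inE mnmBE chiE inE.
by move: (al1 v) (sA v); rewrite !inE; case: (v \in A) => /=; lia.
Qed.

(** A nonzero Koszul class is nonzero on some strand; the multidegree of that strand is squarefree,
    and its support is the required [W]. *)
Lemma koszul_rcoh i t : koszul nonface_ideal i t ->
  exists2 W : {set 'I_n}, #|W| = (i + t)%N & rcoh k rho D W t.
Proof.
case=> z [zM zc nz].
have {nz}[al nal] : exists al, ~ exists e : {set 'I_n} -> k^o,
     (forall A, (#|A| + i.+1)%N = n -> e A != 0 ->
        (chi (~: A) <= al)%MM /\ nonface (al - chi (~: A))%MM) /\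
     (forall A, (#|A| + i)%N = n ->
        dlt1 rho e A = strand al (fun B => z B 0 0) A).
  apply: NNPP => nal; apply: nz.
  have [|w [wM wz]] := @strand_glue _ _ rho _ nonface z i.
    move=> a al; rewrite (ord1 a); apply: NNPP => ne; apply: nal; by exists al.
  by exists w; split=> // A cA m; apply: wM.
set s := strand al (fun B => z B 0 0) in nal.
have sc A : (#|A| + i)%N = n.+1 -> dlt1 rho s A = 0.
  by move=> cA; rewrite -strand_dlt /strand zc // mxE mcoeff0 if_same.
have sP A : (#|A| + i)%N = n -> s A != 0 ->
    [/\ (chi (~: A) <= al)%MM, nonface (al - chi (~: A))%MM & mdeg al = (i + t)%N].
  move=> cA; rewrite /s /strand; case: ifP => [le|]; last by rewrite eqxx.
  have [zI zt] := zM A cA => nz; split=> //; first exact: zI nz.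
  rewrite -(submK le) mdegD mdeg_chi; have := zt 0 _ nz; rewrite addn0 => ->.
  by have := cardsC A; rewrite card_ord; lia.
have [A0 cA0 sA0] : exists2 A : {set 'I_n}, (#|A| + i)%N = n & s A != 0.
  apply: NNPP => s0; apply: nal; exists (fun=> 0); split=> A.
    by rewrite eqxx.
  move=> cA; rewrite /dlt1 dlt0; apply/esym/eqP/negPn/negP => sA.
  by apply: s0; exists A.
have [_ _ dal] := sP A0 cA0 sA0.
(* If [al u] were at least 2, [u] would lie in the support of the monomial both on [A] and on
   [u |: A]; contraction with [u] would then preserve the ideal and kill the strand. *)
have al1 u : (al u <= 1)%N.
  rewrite leqNgt; apply/negP => alu; apply: nal; exists (ctr rho u s); split.
    move=> A cA; rewrite /ctr; case: ifP; first by rewrite eqxx.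
    move=> uA; rewrite scaler_eq0 negb_or => /andP[_] /sP[].
      by rewrite cardsU1 uA; lia.
    have chiu : chi (~: A) = (chi (~: (u |: A)) + U_(u))%MM.
      by rewrite -chi_setC_D1 ?setU11 // setU1K ?uA.
    move=> le nf _; have le' : (chi (~: A) <= al)%MM.
      apply/mnm_lepP => v; have := mnm_lepP le v.
      by rewrite chiu mnmDE mnm1E chiE !inE; case: (u =P v) => [<-|] /=; lia.
    split=> //; move: nf; rewrite /nonface; congr (~~ D _); apply/setP => v.
    rewrite !inE chiu !mnmBE mnmDE mnm1E chiE !inE.
    by case: (u =P v) => [<-|] /=; rewrite ?eqxx /=; lia.
  by move=> A cA; apply: dlt1_ctr => // uA; apply: sc; rewrite cardsU1 uA; lia.
pose W := supp al; have cW : #|W| = (i + t)%N by rewrite -dal -(chi_supp al1) mdeg_chi.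
have s0 A : ~~ (~: W \subset A) -> s A = 0.
  by rewrite -setCS setCK /s /strand chi_le => /negbTE->.
have cCW : (#|~: W| + #|W|)%N = n by rewrite addnC cardsC card_ord.
(* On [B :|: ~: W] the monomial of the strand has support [B], so it lies in the ideal exactly when
   [B] is no face: the strand consists of relative cochains. *)
exists W => //; exists (fun B => twist (~: W) B *: s (B :|: ~: W)); split.
- move=> B sB cB DB; have [->|nz] := eqVneq (s (B :|: ~: W)) 0; first by rewrite scaler0.
  have /sP := nz; rewrite card_setUC // => -[|le nf _]; first by cardlia.
  by move: nf; rewrite /nonface supp_chi_compl // setUCI // DB.
- move=> B sB cB; have := sc (B :|: ~: W); rewrite card_setUC // dlt1_twist // => scB.
  have/eqP := scB ltac:(cardlia); rewrite scaler_eq0 => /orP[/eqP t0|/eqP//].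
  by have := twistK (~: W) B; rewrite t0 mul0r => /esym/eqP; rewrite oner_eq0.
case=> e' [e0 He'].
pose e A : k^o := if ~: W \subset A then twist (~: W) (A :&: W) *: e' (A :&: W) else 0.
have e_0 A : ~~ (~: W \subset A) -> e A = 0 by rewrite /e => /negbTE->.
apply: nal; exists e; split=> A cA; rewrite /s.
  rewrite /e; case: ifPn => [sA|]; last by rewrite eqxx.
  have le : (chi (~: A) <= al)%MM by rewrite chi_le -setCS setCK.
  rewrite scaler_eq0 negb_or => /andP[_ ne]; split=> //.
  rewrite /nonface supp_chi_compl //; apply: contra ne => DA.
  by rewrite e0 ?subsetIr //; have := card_setIUC sA; cardlia.
case: (boolP (~: W \subset A)) => sA; last first.
  rewrite -/s s0 // /dlt1 /dlt big1 // => v vA; rewrite e_0 ?scaler0 //.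
  by apply: contra sA => sA; apply: subset_trans sA (subsetDl _ _).
have cIA := card_setIUC sA; have sIW := subsetIr A W; rewrite -/s.
rewrite -(setIUC sA); move: (A :&: W) cIA sIW => B cB sB; rewrite dlt1_twist //.
have -> : dlt1 rho (fun B => twist (~: W) B *: e (B :|: ~: W)) B = dlt1 rho e' B.
  apply: (@eq_dlt _ _ _ k^o) => v vB; rewrite /e subsetUr setUCI ?subset_setD1 //.
  by rewrite scalerA twistK scale1r.
by rewrite He' //; [rewrite scalerA twistK scale1r | cardlia].
Qed.

(** The relative cocycle is placed in the single multidegree [chi W]; a Koszul primitive would
    yield, through its strand there, a relative primitive. *)
Lemma rcoh_koszul W i t : #|W| = (i + t)%N -> rcoh k rho D W t ->
  koszul nonface_ideal i t.
Proof.
move=> cW [c [c0 cc nc]].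
have cCW : (#|~: W| + #|W|)%N = n by rewrite addnC cardsC card_ord.
have chi1 v : (chi W v <= 1)%N by rewrite chiE; case: (v \in W).
have leE A : (chi (~: A) <= chi W)%MM = (~: W \subset A).
  by rewrite chi_le supp_chi -setCS setCK.
pose s A : k^o := if ~: W \subset A then twist (~: W) (A :&: W) *: c (A :&: W) else 0.
have s_0 A : ~~ (~: W \subset A) -> s A = 0 by rewrite /s => /negbTE->.
have sN A : s A != 0 -> ~: W \subset A /\ c (A :&: W) != 0.
  rewrite /s; case: ifP => [sA|]; last by rewrite eqxx.
  by rewrite scaler_eq0 negb_or => /andP[].
have sU B : B \subset W -> twist (~: W) B *: s (B :|: ~: W) = c B.
  by move=> sB; rewrite /s subsetUr setUCI // scalerA twistK scale1r.
have sc A : (#|A| + i)%N = n.+1 -> dlt1 rho s A = 0.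
  case: (boolP (~: W \subset A)) => sA; last first.
    move=> _; rewrite /dlt1 /dlt big1 // => v vA; rewrite s_0 ?scaler0 //.
    by apply: contra sA => sA; apply: subset_trans sA (subsetDl _ _).
  have cIA := card_setIUC sA; have sIW := subsetIr A W => cA.
  rewrite -(setIUC sA); move: (A :&: W) cIA sIW => B cB sB; rewrite dlt1_twist //.
  rewrite (_ : dlt1 _ _ B = 0) ?scaler0 // -[RHS](cc B) //; last by cardlia.
  by apply: (@eq_dlt _ _ _ k^o) => v vB; rewrite sU // subset_setD1.
pose z A : 'rV[S]_(size [:: 0%N]) := const_mx (s A *: 'X_[chi W - chi (~: A)]).
have zE al A : strand al (fun B => z B 0 0) A = if al == chi W then s A else 0.
  rewrite /strand mxE mcoeffZ mcoeffX; case: (al =P chi W) => [->|ne].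
    rewrite leE eqxx mulr1; case: ifPn => // /s_0->; exact: esym.
  case: ifPn => // le; case: (boolP (~: W \subset A)) => sA; last first.
    by rewrite s_0 // mul0r.
  case: eqP => [e|_]; last by rewrite mulr0.
  by case: ne; rewrite -(submK le) -e submK // leE.
exists z; split.
- move=> A cA; have zAm a m : (z A 0 a)@_m != 0 ->
      [/\ ~: W \subset A, m = (chi W - chi (~: A))%MM & c (A :&: W) != 0].
    rewrite mxE mcoeffZ mcoeffX mulf_eq0 negb_or => /andP[/sN[sA nzc]].
    by case: (_ =P m) => [<-|]; rewrite ?eqxx.
  split=> [m /zAm[sA -> nzc]|a m /zAm[sA -> nzc]].
    rewrite /nonface supp_chi_compl ?leE // supp_chi.
    by apply: contra nzc => DA; rewrite c0 ?subsetIr //; have := card_setIUC sA; cardlia.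
  rewrite (ord1 a) addn0; have := cardsC A; rewrite card_ord.
  suff : #|W| = (mdeg (chi W - chi (~: A)) + #|~: A|)%N by cardlia.
  by rewrite -!mdeg_chi -mdegD submK // leE.
- move=> A cA; apply/rowP => a; apply/mpolyP => m; rewrite (ord1 a) mxE mcoeff0.
  have -> : (dltX rho z A 0 0)@_m = strand (m + chi (~: A)) (fun B => dltX rho z B 0 0) A.
    by rewrite /strand lem_addl addmK.
  rewrite strand_dlt; case: (eqVneq (m + chi (~: A))%MM (chi W)) => [em|ne].
    rewrite -[RHS](sc A) //; apply: (@eq_dlt _ _ _ k^o) => v vA.
    by rewrite zE em eqxx.
  rewrite -[RHS](dlt0 rho k^o (fun=> 1) A); apply: (@eq_dlt _ _ _ k^o) => v vA.
  by rewrite zE (negbTE ne).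
case=> w [wM wz]; apply: nc; pose a := strand (chi W) (fun B => w B 0 0).
have a0 A : ~~ (~: W \subset A) -> a A = 0 by rewrite /a /strand leE => /negbTE->.
have aA A : (#|A| + i)%N = n -> dlt1 rho a A = s A.
  move=> cA; rewrite -strand_dlt {1}/strand wz //.
  by have := zE (chi W) A; rewrite eqxx.
exists (fun B => twist (~: W) B *: a (B :|: ~: W)); split=> B sB cB.
  move=> DB; have [->|] := eqVneq (a (B :|: ~: W)) 0; first by rewrite scaler0.
  rewrite {1}/a /strand leE subsetUr => nz.
  have cBW : (#|B :|: ~: W| + i.+1)%N = n by rewrite card_setUC //; cardlia.
  have := wM _ cBW _ nz; rewrite /nonface supp_chi_compl ?leE ?subsetUr //.
  by rewrite supp_chi setUCI // DB.
rewrite -[LHS]scale1r -(twistK (~: W) B) -scalerA -dlt1_twist //.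
by rewrite aA ?sU // card_setUC //; cardlia.
Qed.

End Hochster.

(** * Dimension shifting *)

Section DimensionShift.
Local Open Scope ring_scope.
Variables (k : fieldType) (n : nat) (rho : 'I_n -> nat).
Hypothesis rho_inj : injective rho.
Local Notation S := {mpoly k[n]}.
Implicit Types (A B W : {set 'I_n}) (m : 'X_{1..n}) (s : seq nat).

Definition vcomp s d (v : 'rV[S]_(size s)) : 'rV[S]_(size s) :=
  \row_b \sum_(m <- msupp (v 0 b) | (mdeg m + nth 0%N s b == d)%N)
     (v 0 b)@_m *: 'X_[m].

(** Matrices of degree-preserving maps between graded free modules. *)
Definition gmx s' s (phi : 'M[S]_(size s', size s)) : Prop :=
  forall a b m, (phi a b)@_m != 0 -> (mdeg m + nth 0 s b = nth 0 s' a)%N.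

Lemma mcoeff_vcomp s d (v : 'rV[S]_(size s)) b m :
  (vcomp d v 0 b)@_m = if (mdeg m + nth 0 s b == d)%N then (v 0 b)@_m else 0.
Proof.
rewrite mxE raddf_sum /= (eq_bigr (fun m' => (v 0 b)@_m' * (m' == m)%:R)); last first.
  by move=> m' _; rewrite mcoeffZ mcoeffX.
case: (boolP (m \in msupp (v 0 b))) => [mv|]; last first.
  rewrite mcoeff_msupp negbK => /eqP v0; rewrite v0 if_same big1 // => m' _.
  by case: (m' =P m) => [->|]; rewrite ?v0 ?mul0r ?mulr0.
case: ifPn => dm.
  rewrite big_mkcond (bigD1_seq m) //= dm eqxx mulr1 big1 ?addr0 // => m' /negbTE ne.
  by rewrite ne mulr0 if_same.
rewrite big1 // => m' dm'; case: (m' =P m) => [em|]; rewrite ?mulr0 //.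
by case/negP: dm; rewrite -em.
Qed.

Lemma vcomp0 s d : vcomp d (0 : 'rV[S]_(size s)) = 0.
Proof.
by apply/rowP => b; apply/mpolyP => m; rewrite mcoeff_vcomp mxE mcoeff0 if_same.
Qed.

Lemma vhom_vcomp s d (v : 'rV[S]_(size s)) : vhom d (vcomp d v).
Proof. by move=> b m; rewrite mcoeff_vcomp; case: ifP => [/eqP|_] //; rewrite eqxx. Qed.

Lemma vcomp_id s d (v : 'rV[S]_(size s)) : vhom d v -> vcomp d v = v.
Proof.
move=> hv; apply/rowP => b; apply/mpolyP => m; rewrite mcoeff_vcomp.
by case: eqP => // ne; have [->|/hv] := eqVneq ((v 0 b)@_m) 0.
Qed.

Lemma dltX_coef p (c : {set 'I_n} -> 'rV[S]_p) A b m :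
  (dltX rho c A 0 b)@_m = \sum_(v in A) (-1) ^+ rk rho v A *
     (if (0 < m v)%N then (c (A :\ v) 0 b)@_(m - U_(v)) else 0).
Proof.
rewrite dltX_entry raddf_sum; apply: eq_bigr => v vA.
by rewrite /= mcoeffZ mcoeff_XM.
Qed.

Lemma mdegB1 m v : (0 < m v)%N -> mdeg m = (mdeg (m - U_(v))%MM).+1.
Proof.
move=> mv; have le : (U_(v) <= m)%MM.
  by apply/mnm_lepP => u; rewrite mnm1E; case: eqP => [<-|].
by rewrite -{1}(submK le) mdegD mdeg1 addn1.
Qed.

Lemma vcomp_dltX s d (c : {set 'I_n} -> 'rV[S]_(size s)) A :
  vcomp d.+1 (dltX rho c A) = dltX rho (fun B => vcomp d (c B)) A.
Proof.
apply/rowP => b; apply/mpolyP => m; rewrite mcoeff_vcomp !dltX_coef.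
case: eqP => [dm|ne].
  apply: eq_bigr => v vA; congr (_ * _); case: ifP => // mv.
  rewrite mcoeff_vcomp ifT //; apply/eqP/succn_inj.
  by rewrite -dm (mdegB1 mv) addSn.
rewrite big1 // => v vA; case: ifP => // mv; last by rewrite mulr0.
rewrite mcoeff_vcomp; case: eqP; rewrite ?mulr0 // => dm.
by case: ne; rewrite (mdegB1 mv) addSn dm.
Qed.

Lemma vcomp0_dltX s (c : {set 'I_n} -> 'rV[S]_(size s)) A :
  vcomp 0 (dltX rho c A) = 0.
Proof.
apply/rowP => b; apply/mpolyP => m; rewrite mcoeff_vcomp mxE mcoeff0.
case: eqP => // /eqP; rewrite addn_eq0 mdeg_eq0 => /andP[/eqP-> _].
by rewrite dltX_coef big1 // => v _; rewrite mnm0E mulr0.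
Qed.

Lemma vcomp_mul s' s (phi : 'M[S]_(size s', size s)) d v : gmx phi ->
  vcomp d (v *m phi) = vcomp d v *m phi.
Proof.
move=> gphi; apply/rowP => b; apply/mpolyP => m; rewrite mcoeff_vcomp !mxE.
rewrite !raddf_sum /=.
case: eqP => [dm|ne].
  apply: eq_bigr => a _; rewrite !mcoeffM; apply: eq_bigr => q /eqP em.
  rewrite mcoeff_vcomp; case: (eqVneq (phi a b)@_q.2 0) => [->|/gphi dq].
    by rewrite !mulr0.
  by rewrite -dq addnA -mdegD -em dm eqxx.
rewrite big1 // => a _; rewrite mcoeffM big1 // => q /eqP em.
rewrite mcoeff_vcomp; case: (eqVneq (phi a b)@_q.2 0) => [->|/gphi dq].
  by rewrite mulr0.
by rewrite -dq addnA -mdegD -em; case: eqP => // _; rewrite mul0r.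
Qed.

Lemma dltX_mul p q (phi : 'M[S]_(p, q)) (c : {set 'I_n} -> 'rV[S]_p) A :
  dltX rho (fun B => c B *m phi) A = dltX rho c A *m phi.
Proof.
by rewrite /dltX /dlt mulmx_suml; apply: eq_bigr => v _; rewrite scalemxAl.
Qed.

Lemma koszul_ext s (M M' : 'rV[S]_(size s) -> Prop) i t :
  (forall v, M v <-> M' v) -> koszul rho M i t <-> koszul rho M' i t.
Proof.
move=> MM'; split=> -[z [zM zc nz]]; exists z; split=> //.
- by move=> A /zM[/MM'].
- by case=> w [wM wz]; apply: nz; exists w; split=> // A /wM /MM'.
- by move=> A /zM[/MM'].
- by case=> w [wM wz]; apply: nz; exists w; split=> // A /wM /MM'.
Qed.

Section Map.
Variables (s' s : seq nat) (phi : 'M[S]_(size s', size s)).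
Hypothesis phi_graded : gmx phi.
Hypothesis phi_min : forall v : 'rV_(size s'), v *m phi = 0 -> forall a, (v 0 a)@_0%MM = 0.

Definition mxim (u : 'rV[S]_(size s)) : Prop := exists v, u = v *m phi.
Definition mxker (v : 'rV[S]_(size s')) : Prop := v *m phi = 0.

(** The connecting map of the sequence kernel, free module, image. The free module contributes only
    constant terms at [i = 0], which [phi_min] excludes from the kernel. The internal degree [t + i]
    is preserved. *)
Lemma koszul_shift i t :
  koszul rho mxker i t <-> exists2 t', t = t'.+1 & koszul rho mxim i.+1 t'.
Proof.
split=> [[z [zM zc nz]]|[t' -> [z [zM zc nz]]]].
  have [i0 a|y yz] := @free_acyclic _ _ _ rho_inj _ z i zc.
    by apply: phi_min; case: (zM setT) => //; rewrite cardsT card_ord i0 addn0.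
  (* A Koszul coboundary has no component of degree 0, so for [t = 0] the cocycle would vanish. *)
  case: t zM nz => [|t] zM nz.
    case: nz; exists (fun=> 0); split=> A cA; first by rewrite /mxker mul0mx.
    by rewrite /dltX dlt0 -(vcomp_id (proj2 (zM A cA))) -yz // vcomp0_dltX.
  exists t => //; pose y' A := vcomp t (y A).
  have y'z A : (#|A| + i)%N = n -> dltX rho y' A = z A.
    by move=> cA; rewrite -vcomp_dltX yz // vcomp_id //; have [] := zM A cA.
  exists (fun A => y' A *m phi); split.
  - move=> A _; split; first by exists (y' A).
    by rewrite /y' -vcomp_mul //; apply: vhom_vcomp.
  - move=> A; rewrite addnS => -[cA]; rewrite dltX_mul y'z //.
    by case: (zM A cA).
  case=> w' [wM wz]; apply: nz.
  (* Lifting [w'] to the free module and subtracting the coboundary of the lift moves [y'] into the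
     kernel without changing its coboundary [z]. *)
  have /choice[w ww'] : forall A, exists v, (#|A| + i.+2)%N = n -> w' A = v *m phi.
    move=> A; case: (eqVneq (#|A| + i.+2)%N n) => [cA|ne].
      by have [v ->] := wM A cA; exists v.
    by exists 0 => e; rewrite e eqxx in ne.
  exists (fun A => y' A - dltX rho w A); split=> A cA.
    rewrite /mxker mulmxBl -dltX_mul -wz // /dltX -dltB -[RHS](dlt0 rho _ (fun v => 'X_v) A).
    apply: eq_dlt => v vA; rewrite ww' ?subrr //; apply: cards_setD1_add vA cA.
  by rewrite /dltX dltB dlt_dlt // subr0 -y'z.
have /choice[y0 zy0] : forall A, exists v, (#|A| + i.+1)%N = n -> z A = v *m phi.
  move=> A; case: (eqVneq (#|A| + i.+1)%N n) => [cA|ne].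
    by have [[v ->] _] := zM A cA; exists v.
  by exists 0 => e; rewrite e eqxx in ne.
pose y A := vcomp t' (y0 A).
have zy A : (#|A| + i.+1)%N = n -> z A = y A *m phi.
  move=> cA; rewrite /y -vcomp_mul // -zy0 // vcomp_id //.
  by have [] := zM A cA.
exists (dltX rho y); split.
- move=> A cA; split; last by rewrite -vcomp_dltX; apply: vhom_vcomp.
  rewrite /mxker -dltX_mul -[RHS](zc A); last by rewrite addnS cA.
  by apply: eq_dlt => v vA; rewrite zy //; apply: cards_setD1_add vA cA.
- by move=> A _; rewrite /dltX dlt_dlt.
case=> w [wM wy]; apply: nz.
(* [y - w] is a cocycle of the free module in positive homological degree, so the condition on
   constant terms is void. *)
have [A|//|u uy] := @free_acyclic _ _ _ rho_inj _ (fun A => y A - w A) i.+1.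
  by rewrite addnS => -[cA]; rewrite /dltX dltB -!/(dltX rho _ _) wy // subrr.
exists (fun A => u A *m phi); split=> [A _|A cA]; first by exists (u A).
by rewrite dltX_mul uy // mulmxBl (wM A cA) subr0 zy.
Qed.

(** Nakayama: Koszul homology in degree 0 is the module modulo its product with the maximal ideal,
    and by minimality the rows of [phi] form a basis of this quotient. *)
Lemma koszul0 j : koszul rho mxim 0 j <-> j \in s'.
Proof.
have cT : (#|[set: 'I_n]| + 0)%N = n by rewrite cardsT card_ord addn0.
have eT A : (#|A| + 0)%N = n -> A = setT.
  rewrite addn0 => cA; apply/eqP; rewrite eqEcard subsetT cardsT card_ord /=.
  by move: cA => /eqP; rewrite eq_sym => /eqP {1}->.
split=> [[z [zM _ nz]]|/(nthP 0%N)[a0 lt_a <-]].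
  apply: contraPT isT => js'; exfalso; apply: nz.
  have [[v0 zv] zh] := zM _ cT; pose v := vcomp j v0.
  have {}zv : z setT = v *m phi by rewrite -vcomp_mul // -zv vcomp_id.
  have [A||y yv] := @free_acyclic _ _ _ rho_inj _ (fun=> v) 0.
  - by rewrite addn0 => cA; have := max_card (mem A); rewrite cA card_ord ltnn.
  - move=> _ a; rewrite mcoeff_vcomp mdeg0 add0n; case: eqP => // ej.
    by rewrite -ej mem_nth in js'.
  exists (fun A => y A *m phi); split=> [A _|A /eT->]; first by exists (y A).
  by rewrite dltX_mul yv.
pose a := Ordinal lt_a.
exists (fun=> row a phi); split.
- move=> A _; split; first by exists (delta_mx 0 a); rewrite rowE.
  by move=> b m; rewrite mxE => /phi_graded.
- by move=> A; rewrite addn0 => cA; have := max_card (mem A); rewrite cA card_ord ltnn.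
case=> w [wM wz].
have /choice[u uw] : forall A, exists v, (#|A| + 1)%N = n -> w A = v *m phi.
  move=> A; case: (eqVneq (#|A| + 1)%N n) => [cA|ne].
    by have [v ->] := wM A cA; exists v.
  by exists 0 => e; rewrite e eqxx in ne.
(* If row [a] were a boundary, the basis vector [a] minus a vector without constant terms would lie
   in the kernel, with constant term 1 at [a]. *)
have /phi_min/(_ a) : (delta_mx 0 a - dltX rho u setT) *m phi = 0.
  rewrite mulmxBl -rowE -(wz _ cT) -dltX_mul /dltX -dltB.
  rewrite -[RHS](dlt0 rho _ (fun v => 'X_v) setT); apply: eq_dlt => v vT.
  by rewrite uw ?subrr //; apply: cards_setD1_add vT cT.
rewrite !mxE mcoeffB !eqxx mcoeff1 eqxx -[X in _ - X]/((dltX rho u setT 0 a)@_0%MM).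
rewrite dltX_coef big1 ?subr0 => [/eqP|v _]; first by rewrite oner_eq0.
by rewrite mnm0E mulr0.
Qed.

End Map.

Definition in_ideal (I : S -> Prop) (v : 'rV[S]_(size [:: 0%N])) : Prop := I (v 0 0).

Lemma graded_entryP d e (p : S) : graded_entry d e p <->
  forall m, p@_m != 0 -> (mdeg m + e = d)%N.
Proof.
rewrite /graded_entry; case: leqP => [le|lt].
  split=> [/dhomogP H m|H].
    by rewrite -mcoeff_msupp => /H /= ->; rewrite subnK.
  by apply/dhomogP => m; rewrite mcoeff_msupp => /H /= <-; rewrite addnK.
split=> [/eqP-> m|H]; first by rewrite mcoeff0 eqxx.
apply/eqP/mpolyP => m; rewrite mcoeff0; apply/eqP/negPn/negP => /H; lia.
Qed.

(** [koszul_shift] is applied along the syzygy modules, lowering [i] at fixed internal degree, until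
    [koszul0] reads off the generators. *)
Lemma koszul_min_resolution (I : S -> Prop) F i t : is_min_resolution I F ->
  koszul rho (in_ideal I) i t <-> (t + i)%N \in shift F i.
Proof.
move=> [augg diffg augi augx diffx mind].
have gd q : gmx (diff F q) by move=> a b; apply/graded_entryP/diffg.
have min_im q v w : v = w *m diff F q -> forall a, (v 0 a)@_0%MM = 0.
  move=> -> a; rewrite mxE raddf_sum big1 // => b _ /=.
  by rewrite rmorphM /= mind mulr0.
have kdiff q j u : koszul rho (mxim (diff F q)) j u <-> (u + j)%N \in shift F (q.+1 + j).
  have mq r (v : 'rV_(size (shift F r.+1))) : v *m diff F r = 0 -> forall a, (v 0 a)@_0%MM = 0.
    by move=> /diffx[w]; apply: min_im.
  elim: j u q => [|j IH] u q; first by rewrite !addn0; apply: koszul0 (gd q) (mq q) u.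
  have := koszul_shift (gd q) (mq q) j u.+1; rewrite addnS -addSn -addSnnS -IH.
  rewrite (koszul_ext (M' := mxim (diff F q.+1))) => [->|v]; last exact: diffx.
  by split=> [K|[u' [->]]] //; exists u.
pose aug' : 'M[S]_(size (shift F 0), size [:: 0%N]) := aug F.
have ga : gmx aug'.
  move=> a b m; rewrite (ord1 b); have /graded_entryP := augg a; exact.
have ma (v : 'rV_(size (shift F 0))) : v *m aug' = 0 -> forall a, (v 0 a)@_0%MM = 0.
  by move=> /augx[w]; apply: min_im.
rewrite (koszul_ext (M' := mxim aug')); last first.
  move=> v; rewrite /in_ideal augi; split=> -[w e]; exists w.
    by rewrite [LHS]mx11_scalar -e.
  by rewrite -[aug F]/aug' -e -mx11_scalar.
case: i => [|i]; first by rewrite addn0; apply: koszul0 ga ma t.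
rewrite -addSnnS -(kdiff 0%N).
have := koszul_shift ga ma i t.+1.
rewrite (koszul_ext (M' := mxim (diff F 0))) => [->|v]; last exact: augx.
by split=> [K|[t' [->]]] //; exists t.
Qed.

End DimensionShift.

(** * Minimal resolutions *)

(** If no matrix had row space [U], every row space inside [U] could be enlarged within [U], and the
    rank would exceed [m]. *)
Lemma subspace_mx (k : fieldType) m (U : 'rV[k]_m -> Prop) :
  U 0%R -> (forall a u v, U u -> U v -> U (a *: u + v)%R) ->
  exists A : 'M[k]_m, forall u, U u <-> (u <= A)%MS.
Proof.
move=> U0 Ulin; apply: NNPP => nA.
have full r : exists A : 'M[k]_m, (forall u, (u <= A)%MS -> U u) /\ r <= \rank A.
  elim: r => [|r [A [AU rA]]].
    by exists 0%R; split=> // u; rewrite submx0 => /eqP->.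
  have [u [Uu uA]] : exists u, U u /\ ~~ (u <= A)%MS.
    apply: NNPP => nu; apply: nA; exists A => u; split=> [Uu|]; last exact: AU.
    by apply/negPn/negP => uA; apply: nu; exists u.
  exists (u + A)%MS; split.
    move=> v /sub_addsmxP[[D E] ->]; rewrite [X in (X *m u)%R]mx11_scalar mul_scalar_mx.
    by apply: Ulin => //; apply: AU; rewrite submxMl.
  apply: leq_ltn_trans rA _; rewrite (ltn_leqif (mxrank_leqif_sup (addsmxSr u A))).
  by rewrite addsmx_sub submx_refl andbT.
by have [A [_]] := full m.+1; rewrite leqNgt ltnS rank_leq_row.
Qed.

Lemma exists_min_size (X : Type) (P : seq X -> Prop) : (exists l, P l) ->
  exists2 l, P l & forall l', P l' -> size l <= size l'.
Proof.
case=> l; move: {2}(size l) (leqnn (size l)) => N; elim: N l => [|N IH] l lN Pl.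
  by exists l => // l' _; move: lN; rewrite leqn0 => /eqP->.
case: (excluded_middle_informative (exists2 l', P l' & size l' < size l)).
  by case=> l' Pl' lt; apply: IH Pl'; rewrite -ltnS (leq_trans lt).
move=> nl; exists l => // l' Pl'; rewrite leqNgt; apply/negP => lt.
by apply: nl; exists l'.
Qed.

Section Span.
Local Open Scope ring_scope.
Variables (R : comNzRingType) (V : lmodType R).
Implicit Types (l : seq (nat * V)) (v u : V).

Definition spanned l v : Prop :=
  exists c : nat -> R, v = \sum_(i < size l) c i *: (nth (0%N, 0) l i).2.

Lemma spanned0 l : spanned l 0.
Proof. by exists (fun=> 0); rewrite big1 // => i _; rewrite scale0r. Qed.

Lemma spannedD l u v : spanned l u -> spanned l v -> spanned l (u + v).
Proof.
case=> [c ->] [e ->]; exists (fun i => c i + e i); rewrite -big_split.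
by apply: eq_bigr => i _; rewrite scalerDl.
Qed.

Lemma spannedZ l a v : spanned l v -> spanned l (a *: v).
Proof.
case=> c ->; exists (fun i => a * c i); rewrite scaler_sumr.
by apply: eq_bigr => i _; rewrite scalerA.
Qed.

Lemma spanned_sum l (J : Type) (r : seq J) (P : pred J) (F : J -> V) :
  (forall j, P j -> spanned l (F j)) -> spanned l (\sum_(j <- r | P j) F j).
Proof.
by move=> H; elim/big_rec: _ => [|j v Pj]; [exact: spanned0 | apply/spannedD/H].
Qed.

Lemma mem_spanned l x : x \in l -> spanned l x.2.
Proof.
case/(nthP (0%N, 0)) => i lt <-; exists (fun j => (j == i)%:R).
rewrite (bigD1 (Ordinal lt)) //= eqxx scale1r big1 ?addr0 // => j ne.
by rewrite (_ : (j == i :> nat) = false) ?scale0r //; apply: negbTE.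
Qed.

Lemma spanned_trans l l' v : (forall x, x \in l -> spanned l' x.2) ->
  spanned l v -> spanned l' v.
Proof.
move=> ll' [c ->]; apply: spanned_sum => i _; apply: spannedZ; apply: ll'.
exact: mem_nth.
Qed.

End Span.

(** * Finite minimal generation of graded submodules with bounded Koszul homology *)

Section Generators.
Local Open Scope ring_scope.
Variables (k : fieldType) (n : nat) (rho : 'I_n -> nat).
Hypothesis rho_inj : injective rho.
Local Notation S := {mpoly k[n]}.
Implicit Types (A : {set 'I_n}) (m : 'X_{1..n}) (s : seq nat).

Definition graded_submodule s (M : 'rV[S]_(size s) -> Prop) : Prop :=
  [/\ M 0, forall u v, M u -> M v -> M (u + v),
      forall p v, M v -> M (p *: v) & forall d v, M v -> M (vcomp d v)].

Section Submodule.
Variables (s : seq nat) (M : 'rV[S]_(size s) -> Prop) (N : nat).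
Hypothesis subM : graded_submodule M.
Hypothesis regM : forall t, koszul rho M 0 t -> (t <= N)%N.

Definition hom_gens (l : seq (nat * 'rV[S]_(size s))) : Prop :=
  forall x, x \in l -> M x.2 /\ vhom x.1 x.2.

(** Only monomials of degree at most [d] occur in degree [d], so this part of [M] is a subspace of a
    finite-dimensional space, encoded by [dec]. *)
Lemma hom_basis d : exists2 l, hom_gens l &
  forall v, M v -> vhom d v -> spanned l v.
Proof.
have [M0 MD MZ _] := subM.
pose J : finType := ('X_{1..n < d.+1} * 'I_(size s))%type.
pose dec (u : 'rV[k]_#|J|) : 'rV[S]_(size s) :=
  \row_b \sum_(m : 'X_{1..n < d.+1}) u 0 (enum_rank (m, b)) *: 'X_[m].
have decE u b m : (dec u 0 b)@_m =
    if insub m is Some m' then u 0 (enum_rank (m' : 'X_{1..n < d.+1}, b)) else 0.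
  rewrite mxE raddf_sum; case: insubP => [m' _ em|nm].
    rewrite (bigD1 m') //= mcoeffZ mcoeffX em eqxx mulr1 big1 ?addr0 // => m'' ne.
    by rewrite mcoeffZ mcoeffX -em (_ : _ == _ = false) ?mulr0 //; apply: negbTE.
  rewrite big1 // => m'' _; rewrite /= mcoeffZ mcoeffX.
  by case: eqP => [em|]; rewrite ?mulr0 //; move: nm; rewrite -em bmdeg.
have dec0 : dec 0 = 0.
  apply/rowP => b; apply/mpolyP => m; rewrite decE mxE mcoeff0.
  by case: insub => // a; rewrite mxE.
have rowD p (u v : 'rV[S]_(size s)) b : (p *: u + v) 0 b = p * u 0 b + v 0 b.
  by rewrite !mxE.
have dec_lin a u v : dec (a *: u + v) = a%:MP *: dec u + dec v.
  apply/rowP => b; apply/mpolyP => m.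
  rewrite rowD mcoeffD mcoeffCM !decE.
  by case: insub => [m'|]; rewrite ?mxE ?mulr0 ?addr0.
pose U u := M (dec u) /\ vhom d (dec u).
have [||B UB] := @subspace_mx k _ U.
- by rewrite /U dec0; split=> // b m; rewrite mxE mcoeff0 eqxx.
- move=> a u v [Mu hu] [Mv hv]; rewrite /U dec_lin; split; first by apply/MD/Mv/MZ.
  move=> b m; rewrite rowD mcoeffD mcoeffCM => nz.
  have [u0|/hu//] := eqVneq ((dec u 0 b)@_m) 0; apply: hv.
  by move: nz; rewrite u0 mulr0 add0r.
pose l := [seq (d, dec (row i B)) | i <- enum 'I_#|J|].
have rowU i : U (row i B) by apply/UB/row_sub.
exists l => [x /mapP[i _ ->]|v Mv hv]; first exact: rowU.
pose u : 'rV[k]_#|J| := \row_j (v 0 (@enum_val J J j).2)@_(@enum_val J J j).1.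
have du : dec u = v.
  apply/rowP => b; apply/mpolyP => m; rewrite decE; case: insubP => [m' _ <-|nm].
    by rewrite mxE enum_rankK.
  apply/esym/eqP/negPn; apply: contra nm => /hv <-; rewrite ltnS; exact: leq_addr.
have /UB/submxP[w uw] : U u by rewrite /U du.
rewrite -du uw mulmx_sum_row; elim: (index_enum _) => [|i r IH].
  by rewrite big_nil dec0; apply: spanned0.
rewrite big_cons dec_lin; apply/spannedD/IH/spannedZ.
apply: (@mem_spanned _ _ l (d, dec (row i B))).
by apply/mapP; exists i; rewrite // mem_enum.
Qed.

Lemma hom_gens_upto d : exists2 l, hom_gens l &
  forall e v, (e <= d)%N -> M v -> vhom e v -> spanned l v.
Proof.
elim: d => [|d [l hl ld]].
  by have [l hl ld] := hom_basis 0; exists l => // e v; rewrite leqn0 => /eqP->; exact: ld.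
have [l' hl' ld'] := hom_basis d.+1; exists (l ++ l').
  by move=> x; rewrite mem_cat => /orP[/hl|/hl'].
move=> e v; rewrite leq_eqVlt => /orP[/eqP-> Mv hv|le Mv hv].
  by apply: spanned_trans (ld' v Mv hv) => x xl; apply: mem_spanned; rewrite mem_cat xl orbT.
by apply: spanned_trans (ld e v le Mv hv) => x xl; apply: mem_spanned; rewrite mem_cat xl.
Qed.

Lemma vcomp_sum (v : 'rV[S]_(size s)) : exists d, v = \sum_(e < d) vcomp e v.
Proof.
pose d := (\max_b (msize (v 0%R b) + nth 0 s b))%N.
exists d; apply/rowP => b; apply/mpolyP => m; rewrite summxE raddf_sum /=.
under eq_bigr => e _ do rewrite mcoeff_vcomp.
have [v0|nz] := eqVneq ((v 0 b)@_m) 0; first by rewrite v0 big1 // => e _; rewrite if_same.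
have lt : (mdeg m + nth 0 s b < d)%N.
  apply: leq_trans (leq_bigmax b); rewrite -addSn leq_add2r.
  by apply: msize_mdeg_lt; rewrite mcoeff_msupp.
rewrite (bigD1 (Ordinal lt)) //= eqxx big1 ?addr0 // => e ne.
by rewrite ifF //; apply/negbTE; rewrite eq_sym.
Qed.

(** Above degree [N] Koszul homology in homological degree 0 vanishes, so a homogeneous element is a
    combination of variables times elements of [M] of degree one lower; induction leads down to
    degree [N]. *)
Lemma hom_gens_span : exists2 l, hom_gens l & forall v, M v -> spanned l v.
Proof.
have [l hl lN] := hom_gens_upto N; exists l => //.
have [_ _ _ Mc] := subM.
suff ld d v : M v -> vhom d v -> spanned l v.
  move=> v Mv; have [d ->] := vcomp_sum v; apply: spanned_sum => e _.
  by apply: (ld e); [apply: Mc | apply: vhom_vcomp].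
elim: d v => [|d IH] v Mv hv; first exact: lN hv.
case: (leqP d.+1 N) => [le|lt]; first exact: lN hv.
have cT : (#|[set: 'I_n]| + 0)%N = n by rewrite cardsT card_ord addn0.
have [w [wM wv]] : exists w : {set 'I_n} -> 'rV[S]_(size s),
    (forall A, (#|A| + 1)%N = n -> M (w A)) /\
    (forall A, (#|A| + 0)%N = n -> dltX rho w A = v).
  apply: NNPP => nw; have : koszul rho M 0 d.+1.
    exists (fun=> v); split=> // A; rewrite addn0 => cA.
    by have := max_card (mem A); rewrite cA card_ord ltnn.
  by move=> /regM; rewrite leqNgt lt.
rewrite -(vcomp_id hv) -(wv _ cT) vcomp_dltX; apply: spanned_sum => u uT.
apply: spannedZ; apply: IH; last exact: vhom_vcomp.
apply/Mc/wM.
exact: cards_setD1_add uT cT.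
Qed.

(** A generating list of least length is minimal: a relation with a nonzero constant term would
    express one generator through the others. *)
Lemma minimal_generators : exists s' (phi : 'M[S]_(size s', size s)),
  [/\ gmx phi, forall v, M v <-> mxim phi v &
      forall v : 'rV_(size s'), v *m phi = 0 -> forall a, (v 0 a)@_0%MM = 0].
Proof.
have [M0 MD MZ _] := subM.
pose P l := hom_gens l /\ forall v, M v -> spanned l v.
have [|l [hl lM] lmin] := @exists_min_size _ P.
  by have [l hl lM] := hom_gens_span; exists l.
pose s' := [seq x.1 | x <- l].
pose phi : 'M[S]_(size s', size s) := \matrix_(a, b) (nth (0%N, 0) l a).2 0 b.
have ss' : size s' = size l by rewrite size_map.
have lt_l (a : 'I_(size s')) : (a < size l)%N by rewrite -ss'.
have rowE a : row a phi = (nth (0%N, 0) l a).2 by apply/rowP => b; rewrite !mxE.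
have s'E (a : 'I_(size s')) : nth 0%N s' a = (nth (0%N, 0) l a).1.
  by rewrite (nth_map (0%N, 0)).
have gphi : gmx phi.
  move=> a b m; rewrite mxE s'E => nz; have [_ hla] := hl _ (mem_nth (0%N, 0) (lt_l a)).
  exact: hla nz.
exists s', phi; split=> // [v|v vphi a].
  split=> [/lM[c ->]|[u ->]].
    exists (\row_a c a); rewrite mulmx_sum_row.
    rewrite (big_ord_widen_cond (size s') xpredT (fun i => c i *: (nth (0%N, 0) l i).2)) ?ss' //=.
    by apply: eq_big => [a|a _]; rewrite ?lt_l // rowE mxE.
  rewrite mulmx_sum_row; elim/big_rec: _ => // a w _; apply: MD; apply: MZ.
  by rewrite rowE; have [] := hl _ (mem_nth (0%N, 0) (lt_l a)).
apply/eqP/negPn/negP => nz; set c := (v 0 a)@_0%MM in nz.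
(* In the component of the degree of generator [a], the coefficient at [a] is the constant [c]
   itself, hence invertible. *)
pose u := vcomp (nth 0%N s' a) v.
have uphi : u *m phi = 0.
  by rewrite -vcomp_mul // vphi vcomp0.
have ua : u 0 a = c%:MP.
  apply/mpolyP => m; rewrite mcoeff_vcomp mcoeffC -[X in (_ == X)%N]add0n eqn_add2r mdeg_eq0.
  by case: eqP => [->|_]; rewrite ?mulr1 ?mulr0.
pose l' := take a l ++ drop a.+1 l.
have l'P i : (i < size l)%N -> i != a :> nat -> nth (0%N, 0) l i \in l'.
  move=> lt ne; rewrite mem_cat; case: (ltngtP i a) ne => // ia _.
    by rewrite -(nth_take _ ia) mem_nth // size_take lt_l.
  by rewrite -(subnKC ia) -nth_drop mem_nth ?orbT // size_drop ltn_sub2r // (leq_ltn_trans ia).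
have rowa : spanned l' (nth (0%N, 0) l a).2.
  have -> : (nth (0%N, 0) l a).2 = \sum_(i < size s' | i != a) (- c^-1%:MP * u 0 i) *: row i phi.
    move: uphi; rewrite mulmx_sum_row (bigD1 a) //= ua => /eqP.
    rewrite addr_eq0 => /eqP/(congr1 (fun w => c^-1%:MP *: w)).
    rewrite scalerA -mpolyCM mulVf // mpolyC1 scale1r rowE => ->.
    rewrite scalerN scaler_sumr -sumrN; apply: eq_bigr => i _.
    by rewrite scalerA mulNr scaleNr.
  apply: spanned_sum => i ne; apply: spannedZ; rewrite rowE.
  by apply: mem_spanned; apply: l'P.
have /lmin : P l'.
  split=> [x|v0 /lM lv].
    by rewrite mem_cat => /orP[/mem_take|/mem_drop]; apply: hl.
  apply: spanned_trans lv => x /(nthP (0%N, 0))[i lt <-].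
  by have [->|ne] := eqVneq i a; rewrite //; apply: mem_spanned; apply: l'P.
by rewrite size_cat size_take lt_l size_drop; have := lt_l a; lia.
Qed.

End Submodule.
End Generators.

(** * Construction of the minimal resolution by iterated minimal covers *)

Section Resolution.
Local Open Scope ring_scope.
Variables (k : fieldType) (n : nat) (rho : 'I_n -> nat).
Hypothesis rho_inj : injective rho.
Local Notation S := {mpoly k[n]}.
Implicit Types (W A B : {set 'I_n}) (m : 'X_{1..n}) (s : seq nat).

Lemma graded_ker s' s (phi : 'M[S]_(size s', size s)) : gmx phi ->
  graded_submodule (mxker phi).
Proof.
move=> gphi; split; rewrite /mxker.
- by rewrite mul0mx.
- by move=> u v u0 v0; rewrite mulmxDl u0 v0 addr0.
- by move=> p v v0; rewrite -scalemxAl v0 scaler0.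
by move=> d v v0; rewrite -vcomp_mul // v0 vcomp0.
Qed.

Variable N : nat.

(** The bound is on the internal degree, which [koszul_shift] preserves; hence one [N] serves all
    syzygy modules. *)
Definition bounded_koszul s (M : 'rV[S]_(size s) -> Prop) : Prop :=
  forall i t, koszul rho M i t -> (t + i <= N)%N.

(** The invariant of the iteration: both properties pass to the kernel of a minimal cover, and
    together they provide the next cover. *)
Record syzygy := Syzygy {
  degs : seq nat;
  syz : 'rV[S]_(size degs) -> Prop;
  syz_graded : graded_submodule syz;
  syz_bounded : bounded_koszul syz
}.

Record cover_of (x : syzygy) := CoverOf {
  next : syzygy;
  cmx : 'M[S]_(size (degs next), size (degs x))
}.

Definition minimal_cover x (y : cover_of x) : Prop :=
  [/\ gmx (cmx y), forall v, syz v <-> mxim (cmx y) v,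
      forall v : 'rV_(size (degs (next y))), v *m cmx y = 0 ->
        forall a, (v 0 a)@_0%MM = 0 &
      forall v : 'rV_(size (degs (next y))), syz v <-> v *m cmx y = 0].

Lemma cover_exists x : exists y : cover_of x, minimal_cover y.
Proof.
have reg0 t : koszul rho (@syz x) 0 t -> (t <= N)%N.
  by move/syz_bounded; rewrite addn0.
have [s' [phi [gphi phiM phi0]]] := minimal_generators (syz_graded x) reg0.
have bker : bounded_koszul (mxker phi).
  move=> i t /(koszul_shift rho_inj gphi phi0)[t' -> K].
  by rewrite addSnnS; apply: (@syz_bounded x); apply/(koszul_ext rho _ _ phiM).
by exists (@CoverOf x (Syzygy (graded_ker gphi) bker) phi); split.
Qed.

Lemma min_resolution_exists (I : S -> Prop) :
  graded_submodule (in_ideal I) -> bounded_koszul (in_ideal I) ->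
  exists F, is_min_resolution I F.
Proof.
move=> gI bI; pose x0 := Syzygy gI bI.
pose cov x := proj1_sig (constructive_indefinite_description _ (cover_exists x)).
have covP x : minimal_cover (cov x) by apply: proj2_sig.
pose x_ := fix x_ q := if q is q'.+1 then next (cov (x_ q')) else next (cov x0).
exists (@GComplex k n (fun q => degs (x_ q)) (cmx (cov x0)) (fun q => cmx (cov (x_ q)))).
have [ga ima mina kera] := covP x0.
(* Each syzygy module after the first is the kernel of a minimal cover, so its elements have no
   constant terms. The rows of the differentials lie in these modules, which makes the resolution
   minimal. *)
have min0 q v : syz v -> forall a : 'I_(size (degs (x_ q))), (v 0 a)@_0%MM = 0.
  case: q v => [|q] v sv; first by apply: mina; apply/kera.
  have [_ _ minq kerq] := covP (x_ q); apply: minq; exact/kerq.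
split=> /=.
- by move=> a; apply/graded_entryP => m /ga.
- by move=> i a b; have [gd _ _ _] := covP (x_ i); apply/graded_entryP => m /gd.
- move=> p; have /= := ima (p%:M); rewrite /in_ideal mxE eqxx mulr1n => ->.
  by split=> -[v e]; exists v.
- move=> v; rewrite -kera; have [_ im0 _ _] := covP (x_ 0%N); exact: im0.
- move=> i v; have [_ _ _ <-] := covP (x_ i).
  by have [_ im0 _ _] := covP (x_ i.+1); exact: im0.
move=> i a b; have [_ im0 _ _] := covP (x_ i).
have /(min0 i) /(_ b) : syz (row a (cmx (cov (x_ i)))).
  by apply/im0; exists (delta_mx 0 a); rewrite rowE.
by rewrite mxE.
Qed.

Variable (D : pred {set 'I_n}) (I : S -> Prop).
Hypothesis closedD : down_closed D.
Hypothesis monoI : forall p, I p <-> forall m, p@_m != 0 -> nonface D m.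

Lemma nonface_idealP v : in_ideal I v <-> nonface_ideal D v.
Proof. exact: monoI. Qed.

Lemma nonface_le m m' : (m <= m')%MM -> nonface D m -> nonface D m'.
Proof.
move=> le; apply: contra; apply: closedD; apply/subsetP => v; rewrite !inE.
by move/leq_trans; apply; apply: (mnm_lepP le).
Qed.

Lemma graded_nonface : graded_submodule (in_ideal I).
Proof.
split.
- by apply/monoI => m; rewrite mxE mcoeff0 eqxx.
- move=> u v /monoI Iu /monoI Iv; apply/monoI => m; rewrite mxE mcoeffD => nz.
  have [u0|/Iu//] := eqVneq ((u 0 0)@_m) 0; apply: Iv.
  by move: nz; rewrite u0 add0r.
- move=> p v /monoI Iv; apply/monoI => m; rewrite mxE => nz.
  apply: contraNT nz => nf; rewrite mcoeffM big1 // => q /eqP em.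
  have [->|/Iv nfq] := eqVneq ((v 0 0)@_q.2) 0; first by rewrite mulr0.
  by case/negP: nf; apply: nonface_le nfq; apply/mnm_lepP => u;
     rewrite [in leqRHS]em mnmDE leq_addl.
move=> d v /monoI Iv; apply/monoI => m; rewrite mcoeff_vcomp.
by case: ifP => [_ /Iv|]; rewrite ?eqxx.
Qed.

Lemma koszul_nonface i t : koszul rho (in_ideal I) i t <->
  exists2 W : {set 'I_n}, #|W| = (i + t)%N & rcoh k rho D W t.
Proof.
rewrite (koszul_ext rho _ _ nonface_idealP).
by split=> [/(koszul_rcoh rho_inj)|[W cW]] //; apply: rcoh_koszul.
Qed.

End Resolution.

(** * Hochster's formula for the nonvanishing of Betti numbers *)

Section Hochster.
Local Open Scope ring_scope.
Variables (k : fieldType) (n : nat) (rho : 'I_n -> nat).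
Hypothesis rho_inj : injective rho.
Variable (D : pred {set 'I_n}) (I : {mpoly k[n]} -> Prop).
Hypothesis closedD : down_closed D.
Hypothesis monoI : forall p, I p <-> forall m, p@_m != 0 -> nonface D m.

Lemma betti_neq0 i t : betti I i (i + t)%N <> 0%N <->
  exists2 W : {set 'I_n}, #|W| = (i + t)%N & rcoh k rho D W t.
Proof.
have resI : is_min_resolution I (min_resolution I).
  (* [N = n] is a valid bound because the internal degree of a nonzero Koszul class is the
     cardinality of a set of variables. *)
  apply: epsilon_spec; apply: (min_resolution_exists rho_inj (N := n)).
    exact: graded_nonface closedD monoI.
  move=> j u /(koszul_nonface rho_inj monoI)[W cW _].
  by have := max_card (mem W); rewrite card_ord cW addnC.
rewrite -(koszul_nonface rho_inj monoI) (koszul_min_resolution rho_inj _ _ resI).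
rewrite /betti addnC; split=> [/eqP|].
  by rewrite -lt0n -has_count has_pred1.
by rewrite -has_pred1 has_count lt0n => /eqP.
Qed.

End Hochster.

(** * The clique complex *)

Section CliqueComplex.
Local Open Scope ring_scope.
Variables (k : fieldType) (T : finType).
Implicit Types (G : sgraph T) (W : {set T}).

Lemma clique_subset G : down_closed (clique G).
Proof.
move=> A B sAB /andP[sB cB]; rewrite /clique (subset_trans sAB sB) /=.
apply/forall_inP => x xA; apply/forall_inP => y yA.
move/forall_inP: cB => /(_ x (subsetP sAB x xA))/forall_inP.
by apply; apply: (subsetP sAB).
Qed.

Lemma clique_gcap (G H : sgraph T) C :
  clique (gcap G H) C = clique G C && clique H C.
Proof.
apply/andP/andP => [[]|[/andP[sG /forall_inP cG] /andP[sH /forall_inP cH]]].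
  rewrite subsetI => /andP[sG sH] /forall_inP cC.
  by split; apply/andP; split=> //; apply/forall_inP => x xC;
     apply/forall_inP => y yC; apply/implyP => ne;
     move/forall_inP: (cC x xC) => /(_ y yC); rewrite ne => /andP[].
rewrite subsetI sG sH; split=> //; apply/forall_inP => x xC.
apply/forall_inP => y yC; apply/implyP => ne.
move/forall_inP: (cG x xC) => /(_ y yC); move/forall_inP: (cH x xC) => /(_ y yC).
by rewrite ne /= /gcap_edge => -> ->.
Qed.

Let rank (x : T) : nat := enum_rank x.

Lemma rank_inj : injective rank.
Proof. by move=> x y /ord_inj/enum_rank_inj. Qed.

(** The complex whose only face is the empty set has its single class at [b = 0], which matches the
    convention of regularity 1 for complete graphs. *)
Lemma coh_set0 G b : coh k rank (clique G) set0 b <-> b = 0%N.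
Proof.
split=> [[c [_ nc]]|->].
  case: b => // b in nc *; case: nc; exists (fun=> 0) => B.
  by rewrite subset0 => /eqP->; rewrite cards0.
exists (fun=> 1); split=> [B|[e /(_ set0)]].
  by rewrite subset0 => /eqP->; rewrite cards0.
rewrite sub0set cards0 /clique sub0set /dlt1 /dlt big_set0 => /(_ isT erefl).
suff -> : [forall x in set0, [forall y in set0, (x != y) ==> edge G x y]].
  by move/(_ isT)/esym/eqP; rewrite oner_eq0.
by apply/forall_inP => x; rewrite inE.
Qed.

Section Numbering.
Variable G : sgraph T.
Local Notation n := #|vset G|.

Let lbl (i : 'I_n) : T := enum_val i.
Let lbl_inj : injective lbl. Proof. exact: enum_val_inj. Qed.
Definition face (A : {set 'I_n}) : bool := clique G (lbl @: A).

Lemma nrank_inj : injective (rank \o lbl).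
Proof. exact: inj_comp rank_inj lbl_inj. Qed.

Lemma face_closed : down_closed face.
Proof. by move=> A B sAB; apply: clique_subset; apply: imsetS. Qed.

Lemma faceP (A : {set 'I_n}) : reflect (forall i j, i \in A -> j \in A -> ~~ nonedge i j) (face A).
Proof.
have sV : lbl @: A \subset vset G by apply/subsetP => _ /imsetP[i _ ->]; apply: enum_valP.
rewrite /face /clique sV /=; apply: (iffP forall_inP) => [cA i j iA jA|H].
  have /forall_inP/(_ (lbl j) (imset_f _ jA)) := cA (lbl i) (imset_f _ iA).
  by rewrite /nonedge (inj_eq lbl_inj) negb_and !negbK -implyNb.
move=> _ /imsetP[i iA ->]; apply/forall_inP => _ /imsetP[j jA ->].
have := H i j iA jA.
by rewrite /nonedge (inj_eq lbl_inj) negb_and !negbK -implyNb.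
Qed.

(** A set that is no clique contains a non-edge, so a monomial with such a support is divisible by a
    generator. *)
Lemma nonedge_idealP (p : {mpoly k[n]}) :
  nonedge_ideal p <-> forall m, p@_m != 0 -> nonface face m.
Proof.
split=> [[c ->] m|H].
  rewrite /nonface; apply: contra => /faceP fm.
  rewrite raddf_sum big1 // => i _; rewrite raddf_sum big1 // => j ne /=.
  rewrite mulrC -mulrA !mcoeff_XM; case: ifP => // mi; case: ifP => // mj.
  have /negP[] // : ~~ nonedge i j.
  by apply: fm; rewrite inE //; move: mj; rewrite mnmBE; lia.
have I0 : nonedge_ideal (0 : {mpoly k[n]}).
  by exists (fun _ _ => 0); rewrite big1 // => i _; rewrite big1 // => j _; rewrite mul0r.
have ID (p1 p2 : {mpoly k[n]}) : nonedge_ideal p1 -> nonedge_ideal p2 -> nonedge_ideal (p1 + p2).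
  move=> [c1 ->] [c2 ->]; exists (fun i j => c1 i j + c2 i j).
  rewrite -big_split; apply: eq_bigr => i _; rewrite -big_split.
  by apply: eq_bigr => j _; rewrite mulrDl.
have IX i j (q : {mpoly k[n]}) : nonedge i j -> nonedge_ideal (q * ('X_i * 'X_j)).
  move=> ne; exists (fun i' j' => if (i' == i) && (j' == j) then q else 0).
  rewrite (bigD1 i) //= [X in _ + X]big1 ?addr0 => [|i' /negbTE ii]; last first.
    by rewrite big1 // => j' _; rewrite ii mul0r.
  rewrite (bigD1 j) //= !eqxx big1 ?addr0 // => j' /andP[_ /negbTE jj].
  by rewrite jj andbF mul0r.
rewrite (mpolyE p) big_seq; elim/big_rec: _ => // m q; rewrite mcoeff_msupp => /H nf.
apply: ID; have [i [j [mi mj ne]]] : exists i j, [/\ 0 < m i, 0 < m j & nonedge i j]%N.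
  apply: NNPP => nij; case/negP: nf; apply/faceP => i j; rewrite !inE => mi mj.
  by apply/negP => ne; apply: nij; exists i, j.
have le : (U_(i) + U_(j) <= m)%MM.
  have ij : i != j by case/andP: ne.
  apply/mnm_lepP => v; rewrite mnmDE !mnm1E; case: (eqVneq i v) => [<-|] /=.
    by rewrite eq_sym (negbTE ij) addn0.
  by case: (eqVneq j v) => [<-|].
by rewrite -(submK le) mpolyXD mpolyXD scalerAl; apply: IX.
Qed.

Lemma betti_face i t : betti (@nonedge_ideal k T G) i (i + t)%N <> 0%N <->
  exists2 W : {set 'I_n}, #|W| = (i + t)%N & rcoh k (rank \o lbl) face W t.
Proof.
apply: betti_neq0 => [|A B|p].
- exact: nrank_inj.
- exact: face_closed.
- exact: nonedge_idealP.
Qed.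

Lemma face0 : face set0.
Proof. by apply/faceP => i j; rewrite inE. Qed.

(** Cliques contain only vertices of [G], so [W] may be cut down to these before renumbering. *)
Lemma coh_face W b :
  coh k rank (clique G) W b <-> coh k (rank \o lbl) face (lbl @^-1: W) b.
Proof.
have eW : lbl @: (lbl @^-1: W) = W :&: vset G.
  apply/setP => x; rewrite inE; apply/imsetP/andP => [[i]|[xW xG]].
    by rewrite inE => iW ->; split=> //; apply: enum_valP.
  by exists (enum_rank_in xG x); rewrite /lbl ?inE enum_rankK_in.
rewrite -coh_imset // eW; apply: coh_subset; last exact: subsetIl.
by move=> B sB /andP[sV _]; rewrite subsetI sB.
Qed.

Lemma coh_preim0 W b : lbl @^-1: W = set0 -> coh k rank (clique G) W b -> b = 0%N.
Proof.
move=> W0; rewrite coh_face W0 => [[c [_ nc]]].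
case: b => // b in nc *; case: nc; exists (fun=> 0) => B.
by rewrite subset0 => /eqP->; rewrite cards0.
Qed.

(** With a non-edge, the indices of nonzero Betti numbers form a nonempty bounded set, so [epsilon]
    returns its maximum. The shift by one comes from the connecting map of the pair. *)
Lemma regularity_coh : ~~ complete G ->
  [/\ (0 < reg k G)%N, exists W, coh k rank (clique G) W (reg k G).-1 &
      forall W b, coh k rank (clique G) W b -> (b < reg k G)%N].
Proof.
move=> ncG; have [i [j ne]] : exists i j : 'I_n, nonedge i j.
  apply: NNPP => nij; case/negP: ncG.
  have /faceP : forall i j : 'I_n, i \in setT -> j \in setT -> ~~ nonedge i j.
    by move=> i j _ _; apply/negP => ne; apply: nij; exists i, j.
  rewrite /face; congr clique; apply/setP => x; apply/imsetP/idP => [[u _ ->]|xG].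
    exact: enum_valP.
  by exists (enum_rank_in xG x); rewrite /lbl ?inE ?enum_rankK_in.
have ij : i != j by case/andP: ne.
(* Two non-adjacent vertices form a disconnected complex; the indicator of one of them is a cocycle
   that is not constant. *)
have b2 : betti (@nonedge_ideal k T G) 0 (0 + 2) <> 0%N.
  apply/betti_face; exists [set i; j]; first by rewrite cards2 ij.
  apply: (coh_rcoh nrank_inj face_closed); first by apply/set0Pn; exists i; rewrite !inE eqxx.
  exists (fun B => if B == [set i] then 1 else 0); split.
    move=> B sB cB fB; have eB : B = [set i; j].
      by apply/eqP; rewrite eqEcard sB cards2 ij cB.
    have /negP[] // : ~~ nonedge i j.
    by apply: (faceP _ fB); rewrite eB !inE eqxx ?orbT.
  case=> e He.
  have e1 v : v \in [set i; j] -> e set0 = if [set v] == [set i] then 1 else 0.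
    move=> vij; rewrite -(He [set v]) ?sub1set ?cards1 //.
      rewrite /dlt1 /dlt big_set1 setDv mulr1 (_ : rk _ _ _ = 0%N) ?scale1r //.
      apply/eqP; rewrite cards_eq0; apply/eqP/setP => w; rewrite !inE.
      by case: (w =P v) => //= ->; rewrite ltnn.
    by apply/faceP => x y; rewrite !inE => /eqP-> /eqP->; rewrite /nonedge eqxx.
  have := e1 i; rewrite !inE eqxx => /(_ isT); rewrite (e1 j) ?inE ?eqxx ?orbT //.
  rewrite (inj_eq set1_inj) eq_sym (negbTE ij) => /esym/eqP; by rewrite oner_eq0.
have bnd s u : betti (@nonedge_ideal k T G) u (u + s) <> 0%N -> (s <= n)%N.
  move/betti_face => [W _ /rcoh_card le]; apply: leq_trans le _.
  by rewrite -[X in (_ <= X)%N]card_ord max_card.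
have [r [[u ru] rmax]] : exists r, is_regularity (@nonedge_ideal k T G) r.
  (* A nonzero index is replaced by a larger one as long as possible; [d] bounds the distance left
     to [n]. *)
  suff max d b u : betti (@nonedge_ideal k T G) u (u + b) <> 0%N -> (n - b <= d)%N ->
      exists r, is_regularity (@nonedge_ideal k T G) r.
    exact: max (n - 2)%N 2%N 0%N b2 (leqnn _).
  elim: d b u => [|d IH] b u bP dP.
    exists b; split; first by exists u.
    by move=> u' s /bnd; have := bnd _ _ bP; lia.
  case: (excluded_middle_informative (exists u' s,
      betti (@nonedge_ideal k T G) u' (u' + s) <> 0%N /\ (b < s)%N)).
    by move=> [u' [s [sP lt]]]; apply: (IH s u') => //; have := bnd _ _ sP; lia.
  move=> nx; exists b; split; first by exists u.
  by move=> u' s sP; rewrite leqNgt; apply/negP => lt; apply: nx; exists u', s.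
have isr : is_regularity (@nonedge_ideal k T G) (reg k G).
  by rewrite /reg (negbTE ncG); apply: epsilon_spec; exists r; split=> //; exists u.
case: isr => -[u1 /betti_face[W cW rW]] max1.
have r2 : (2 <= reg k G)%N by apply: (max1 0%N 2%N).
have W0 : W != set0 by rewrite -card_gt0 cW; lia.
split=> [||V b cV]; first by lia.
  exists (lbl @: W); rewrite coh_face.
  have -> : lbl @^-1: (lbl @: W) = W.
    by apply/setP => v; rewrite inE (mem_imset _ _ lbl_inj).
  by have [] := rcoh_coh nrank_inj face_closed face0 W0 rW.
have [/coh_preim0/(_ cV)->|V0] := eqVneq (lbl @^-1: V) set0; first by lia.
have rV := coh_rcoh nrank_inj face_closed V0 (proj1 (coh_face V b) cV).
(* The homological degree is forced by [#|W| = i + t] with [t = b + 1]. *)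
have leV := rcoh_card rV; apply: (max1 (#|lbl @^-1: V| - b.+1)%N b.+1).
by apply/betti_face; exists (lbl @^-1: V); rewrite ?subnK.
Qed.

End Numbering.

(** For a complete graph all induced complexes are full simplices, acyclic unless they have no
    vertex, so the convention fits the same description. *)
Lemma regularity_spec G :
  [/\ (0 < reg k G)%N, exists W, coh k rank (clique G) W (reg k G).-1 &
      forall W b, coh k rank (clique G) W b -> (b < reg k G)%N].
Proof.
case: (boolP (complete G)) => cG; last exact: regularity_coh.
rewrite /reg cG; split=> // [|W b cW]; first by exists set0; apply/coh_set0.
have sW (B : {set T}) : B \subset W -> clique G B -> B \subset W :&: vset G.
  by move=> sB /andP[sV _]; rewrite subsetI sB.
have {}cW := proj1 (coh_subset _ _ _ sW (subsetIl W _)) cW.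
have [W0|W0] := eqVneq (W :&: vset G) set0.
  by move: cW; rewrite W0 => /coh_set0->.
case: cW => c [cc nc]; case: nc.
have [|e He] := simplex_acyclic rank_inj W0 (c := c) (b := b).
  move=> B sB cB; apply: cc => //; apply: clique_subset cG.
  by apply: subset_trans sB (subsetIr _ _).
by exists e => B sB cB _; apply: He.
Qed.

End CliqueComplex.

Theorem theorem1p1 (k : fieldType) (char0 : [pchar k]%R =i pred0)
    (T : finType) (G G1 G2 : sgraph T)
    (sub1 : subgraph G1 G) (sub2 : subgraph G2 G)
    (cover : forall C : {set T}, clique G C -> clique G1 C || clique G2 C) :
  reg k G <= maxn (maxn (reg k G1) (reg k G2)) (reg k (gcap G1 G2)).+1.
Proof.
have [r0 [W cW] _] := regularity_spec k G.
have sub_clique H C : subgraph H G -> clique H C -> clique G C.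
  case=> sV sE /andP[sC /forall_inP cC]; apply/andP; split.
    exact: subset_trans sC sV.
  apply/forall_inP => x xC; apply/forall_inP => y yC; apply/implyP => ne.
  by apply: sE; move/forall_inP: (cC x xC) => /(_ y yC); rewrite ne.
(* [cover] and the subgraph hypotheses make the cliques of [G] exactly those of [G1] together with
   those of [G2]. *)
have {cW} /mayer_vietoris[] : coh k (fun x : T => enum_rank x)
    (fun C => clique G1 C || clique G2 C) W (reg k G).-1.
- apply: eq_coh cW => C _; apply/idP/orP => [/cover/orP//|[]]; exact: sub_clique.
- exact: rank_inj.
- exact: clique_subset.
- exact: clique_subset.
- have [_ _ max1] := regularity_spec k G1 => /max1.
  by rewrite prednK // !leq_max => ->.
- have [_ _ max2] := regularity_spec k G2 => /max2.
  by rewrite prednK // !leq_max => ->; rewrite orbT.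
have [_ _ max3] := regularity_spec k (gcap G1 G2).
case=> r1 /(eq_coh (D' := clique (gcap G1 G2)) (fun B _ => esym (clique_gcap G1 G2 B))).
(* The class on the intersection sits one degree lower, which accounts for the summand 1. *)
move=> /max3 lt; rewrite leq_max; apply/orP; right; lia.
Qed.
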